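(* Let $X\in\{B,C,D\}$ and $\lambda$ a strict partition. For every simple index $i$ ($i\in\{0,1,2,\dots\}$ for $B,C$; $i\in\{\hat1,1,2,\dots\}$ for $D$), $$\pi_iGX_\lambda(x|b)=\begin{cases}GX_{\lambda^{(i)}}(x|b)&\text{if }\lambda\text{ is }i\text{-removable},\\-\beta\,GX_\lambda(x|b)&\text{otherwise.}\end{cases}$$
   Context: $\beta$ indeterminate; $x\oplus y=x+y+\beta xy$, $x\ominus y=(x-y)/(1+\beta y)$, $\ominus y=0\ominus y$. $\mathcal{R}=\mathbb{Z}[\beta][b_1,b_2,\dots][(1+\beta b_i)^{-1}]$. For strict $\lambda=(\lambda_1>\dots>\lambda_r>0)$, $r\le n$: $GP_\lambda(x_1,\dots,x_n|b)=\frac1{(n-r)!}\sum_{w\in S_n}w\big[\prod_{j=1}^r\prod_{k=1}^{\lambda_j}(x_j\oplus b_k)\prod_{i=1}^r\prod_{j=i+1}^n\frac{x_i\oplus x_j}{x_i\ominus x_j}\big]$; $GQ_\lambda$ same with $(x_j\oplus x_j)\prod_{k=1}^{\lambda_j-1}(x_j\oplus b_k)$. $G\Gamma_n$: symmetric $f\in\mathbb{Z}[\beta][x_1,\dots,x_n]$ with $f|_{x_i=t,x_j=\ominus t}$ independent of $t$ for all $i<j$; $G\Gamma_{n,+}$: those $F$ with $F(t,x_2,\dots)-F(0,x_2,\dots)$ divisible by $t\oplus t$. $G\Gamma=\varprojlim G\Gamma_n$, $G\Gamma_+=\varprojlim G\Gamma_{n,+}$ under $x_{n+1}\mapsto0$.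 $GB_\lambda(x|b)=\varprojlim_n GP_\lambda(x_1,\dots,x_n|0,b_1,b_2,\dots)$, $GC_\lambda(x|b)=\varprojlim_n GQ_\lambda(x_1,\dots,x_n|b)$, $GD_\lambda(x|b)=\varprojlim_{n\text{ even}}GP_\lambda(x_1,\dots,x_n|b)$ (these families are stable). $GB_\lambda,GD_\lambda\in\mathcal{R}\otimes_{\mathbb{Z}[\beta]}G\Gamma$, $GC_\lambda\in\mathcal{R}\otimes_{\mathbb{Z}[\beta]}G\Gamma_+$. Operators: $s_i$ ($i\ge1$) acts on coefficients by exchanging $b_i$ and $b_{i+1}$; $s_0$ acts by $\phi(x_1,x_2,\dots)\mapsto\phi(b_1,x_1,x_2,\dots)$ on $\phi\in G\Gamma$ and by $b_1\mapsto\ominus b_1$, $b_k\mapsto b_k$ ($k\ge2$) on $\mathcal{R}$, multiplicatively; $s_{\hat1}=s_0s_1s_0$. With $e(\alpha_0)=b_1$ (type $B$), $e(\alpha_0)=b_1\oplus b_1$ (type $C$), $e(\alpha_{\hat1})=b_1\oplus b_2$ (type $D$), $e(\alpha_i)=b_{i+1}\ominus b_i$ ($i\ge1$), define $\pi_iF=\big(s_iF-(1+\beta e(\alpha_i))F\big)/e(\alpha_i)$. Shifted diagram $\mathbb{D}(\lambda)=\{(i,j):1\le i\le r,\ i\le j\le\lambda_i+i-1\}$. Content: for $B,C$, $c(i,j)=j-i$; for $D$, $c(i,j)=j-i+1$ if $i<j$, $c(i,i)=\hat1$ if $i$ odd and $1$ if $i$ even. $\lambda$ is $i$-removable if some box $\alpha\in\mathbb{D}(\lambda)$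 with $c(\alpha)=i$ has $\mathbb{D}(\lambda)\setminus\{\alpha\}$ a shifted diagram, which is then $\mathbb{D}(\lambda^{(i)})$. (Equivalently, $s_i\lambda<\lambda$ in the Bruhat order.) *)

(* Defs.v *)
From HB Require Import structures.
From mathcomp Require Import all_boot all_order all_algebra perm.
From mathcomp Require Import finmap.
From mathcomp Require Import -(notations) monalg.
From mathcomp Require Import mpoly.
From Stdlib Require Import ClassicalEpsilon.

Set Implicit Arguments.
Unset Strict Implicit.
Unset Printing Implicit Defensive.

Import GRing.Theory.
Local Open Scope ring_scope.

(* Z[beta][b_1, b_2, ...]; the variable of index k : nat stands for b_(k+1) *)
Definition bpoly : Type := monalg.malg (monalg.cmonom nat) {poly int}.

HB.instance Definition _ := GRing.ComNzRing.on bpoly.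

Section BpolyIdomain.

Definition bpoly_unit : pred bpoly :=
  fun p => if excluded_middle_informative (exists q, q * p = 1) then true
           else false.

Definition bpoly_inv (p : bpoly) : bpoly :=
  if bpoly_unit p then epsilon (inhabits p) (fun q => q * p = 1) else p.

Lemma bpoly_unitP p : reflect (exists q, q * p = 1) (bpoly_unit p).
Proof.
by rewrite /bpoly_unit; case: excluded_middle_informative => h; constructor.
Qed.

Lemma bpoly_mulVp : {in bpoly_unit, left_inverse 1 bpoly_inv *%R}.
Proof.
move=> p; rewrite /bpoly_inv -topredE /= => up; rewrite up.
by move/bpoly_unitP: up => up; apply: (epsilon_spec (inhabits p) _ up).
Qed.

Lemma bpoly_intro_unit p q : q * p = 1 -> p \in bpoly_unit.
Proof. by move=> qp; apply/bpoly_unitP; exists q. Qed.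

Lemma bpoly_inv_out : {in [predC bpoly_unit], bpoly_inv =1 id}.
Proof.
by move=> p; rewrite inE -topredE /= => /negbTE up; rewrite /bpoly_inv up.
Qed.

Definition mtrunc N (m : monalg.cmonom nat) : 'X_{1..N} :=
  [multinom m (i : nat) | i < N].

Definition mevalX N (m : monalg.cmonom nat) : {mpoly {poly int}[N]} :=
  'X_[mtrunc N m].

Lemma mevalX_morph N : monalg.mmorphism (mevalX N).
Proof.
split=> [m1 m2|]; rewrite /mevalX.
  rewrite -mpolyXD; congr 'X_[_]; apply/mnmP=> i.
  by rewrite mnmDE !mnmE monalg.cmM.
rewrite -mpolyX0; congr 'X_[_]; apply/mnmP=> i.
by rewrite mnm0E mnmE monalg.cm1.
Qed.

HB.instance Definition _ N :=
  monalg.isMultiplicative.Build _ _ (mevalX N) (mevalX_morph N).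

Definition bpoly_trunc N : bpoly -> {mpoly {poly int}[N]} :=
  monalg.mmap (@mpolyC N {poly int}) (mevalX N).

Lemma bpoly_truncM N : {morph @bpoly_trunc N : p q / p * q}.
Proof. by move=> p q; rewrite /bpoly_trunc; exact: rmorphM. Qed.

Definition bnd (p : bpoly) N :=
  forall m i, m \in monalg.msupp p -> (N <= i)%N -> m i = 0%N.

Lemma bnd_ex p : exists N, forall M, (N <= M)%N -> bnd p M.
Proof.
exists (\max_(m <- monalg.msupp p) \max_(i <- finsupp (m : monalg.cmonom nat))
   i.+1)%N => M leM m i mp leMi.
apply/eqP; rewrite monalg.cmE_eq0; apply/negP => im.
have: (i.+1 <= i)%N; last by rewrite ltnn.
apply: leq_trans leMi; apply: leq_trans leM.
apply: leq_trans (leq_bigmax_seq _ mp isT) => /=.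
by apply: (leq_bigmax_seq (F := succn)) im isT.
Qed.

Lemma bpoly_trunc_eq0 p N : bnd p N -> bpoly_trunc N p = 0 -> p = 0.
Proof.
move=> bp p0; apply/monalg.malgP => m; rewrite monalg.mcoeff0.
have [mp|] := boolP (m \in monalg.msupp p); last first.
  by rewrite -monalg.mcoeff_eq0 => /eqP.
have := congr1 (mcoeff (mtrunc N m)) p0; rewrite mcoeff0 => <-.
rewrite /bpoly_trunc monalg.mmapE raddf_sum /= (big_fsetD1 m) //=.
rewrite mcoeffCM mcoeffX eqxx mulr1 big_seq big1 ?addr0 // => k.
rewrite in_fsetD1 => /andP[km kp]; rewrite mcoeffCM mcoeffX.
case: eqP => [E|]; last by rewrite mulr0.
case/eqP: km; apply/eqP/monalg.cmP => i; have [iN|Ni] := ltnP i N.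
  by have := congr1 (fun t : 'X_{1..N} => t (Ordinal iN)) E; rewrite !mnmE.
by rewrite (bp _ _ kp Ni) (bp _ _ mp Ni).
Qed.

Lemma bpoly_idomainAxiom (p q : bpoly) : p * q = 0 -> (p == 0) || (q == 0).
Proof.
move=> pq; have [[N1 b1] [N2 b2]] := (bnd_ex p, bnd_ex q).
have := congr1 (bpoly_trunc (maxn N1 N2)) pq.
rewrite bpoly_truncM [X in _ = X]raddf0 => /eqP; rewrite mulf_eq0.
case/orP => /eqP /bpoly_trunc_eq0 ->; rewrite ?eqxx ?orbT //.
  by apply: b1; exact: leq_maxl.
by apply: b2; exact: leq_maxr.
Qed.

End BpolyIdomain.

HB.instance Definition _ := GRing.ComNzRing_hasMulInverse.Build bpoly
  bpoly_mulVp bpoly_intro_unit bpoly_inv_out.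
HB.instance Definition _ :=
  GRing.ComUnitRing_isIntegral.Build bpoly bpoly_idomainAxiom.

(* The fraction field of Z[beta][b_1, b_2, ...], which contains the coefficient
   ring R = Z[beta][b_1, b_2, ...][(1 + beta b_i)^-1]; the divisions by
   e(alpha_i) take place here. *)
Definition coef : fieldType := {fraction bpoly}.

Definition zb_coef (c : {poly int}) : coef :=
  FracField.tofrac (monalg.mkmalgU (monalg.onecm nat) c : bpoly).

Definition beta : coef := zb_coef 'X.

(* b k is b_k for k >= 1 (b 0 is a junk value). *)
Definition b (k : nat) : coef :=
  FracField.tofrac (monalg.mkmalgU (monalg.ucm k.-1) 1 : bpoly).

Section FormalGroup.
Variables (K : fieldType) (bt : K).
Definition oplus (x y : K) : K := x + y + bt * x * y.
Definition ominus (x y : K) : K := (x - y) / (1 + bt * y).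
End FormalGroup.

Notation "x '(+)_' bt y" := (oplus bt x y)
  (at level 50, bt at level 2, y at next level, format "x  '(+)_' bt  y").
Notation "x '(-)_' bt y" := (ominus bt x y)
  (at level 50, bt at level 2, y at next level, format "x  '(-)_' bt  y").

(* Substitution b_k |-> v k (k >= 1), on polynomials and then on fractions. It is
   a field morphism as soon as it is injective on polynomials, which is the case
   of the two substitutions (sigma and sigma0) used below. *)
Definition subst_bpoly (v : nat -> coef) (p : bpoly) : coef :=
  monalg.mmap zb_coef
    (fun m : monalg.cmonom nat => \prod_(k <- finsupp m) v k.+1 ^+ m k) p.

Definition subst_coef (v : nat -> coef) (u : coef) : coef :=
  subst_bpoly v \n_(repr u) / subst_bpoly v \d_(repr u).

Definition sigma (i : nat) : coef -> coef :=
  subst_coef (fun k => if k == i then b i.+1 else if k == i.+1 then b i else b k).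

Definition sigma0 : coef -> coef :=
  subst_coef (fun k => if k == 1%N then 0 (-)_beta b 1 else b k).

Definition strict_partition (la : seq nat) : bool :=
  sorted gtn la && (0%N \notin la).

Section FiniteLevel.
Variable n : nat.

Let K : fieldType := {fraction {mpoly coef[n]}}.

Definition xconst (c : coef) : K := FracField.tofrac (c%:MP : {mpoly coef[n]}).
Definition xvar (i : 'I_n) : K := FracField.tofrac ('X_i : {mpoly coef[n]}).

(* Common shape of GP and GQ: row j (0-based, of length l = la_(j+1))
   contributes g l x_j; the permutation w acts by x_j |-> x_(w j). *)
Definition symmetrize (g : nat -> K -> K) (la : seq nat) : K :=
  ((n - size la)`!%:R)^-1 *
  \sum_(w : 'S_n)
    (\prod_(j < n | (j < size la)%N) g (nth 0%N la j) (xvar (w j))) *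
    (\prod_(i < n | (i < size la)%N) \prod_(j < n | (i < j)%N)
       ((xvar (w i) (+)_(xconst beta) xvar (w j)) /
        (xvar (w i) (-)_(xconst beta) xvar (w j)))).

Definition GP (la : seq nat) (c : nat -> coef) : K :=
  symmetrize
    (fun l x => \prod_(1 <= k < l.+1) (x (+)_(xconst beta) xconst (c k))) la.

Definition GQ (la : seq nat) (c : nat -> coef) : K :=
  symmetrize
    (fun l x => (x (+)_(xconst beta) x) *
       \prod_(1 <= k < l) (x (+)_(xconst beta) xconst (c k))) la.

End FiniteLevel.

Inductive ctype := tB | tC | tD.

Definition GX_level (X : ctype) (la : seq nat) (n : nat) :
    {fraction {mpoly coef[n]}} :=
  match X with
  | tB => GP n la (fun k => if k == 1%N then 0 else b k.-1)
  | tC => GQ n la b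
  | tD => GP n la b
  end.

(* The operators act on arbitrary families (F_n)_n with F_n in coef[x_1..x_n];
   R (x) GGamma is the part of the inverse limit (the families with
   F_n = F_(n+1)|x_(n+1)=0) spanned over R by symmetric families satisfying the
   cancellation property. *)
Definition xfamily := forall n, {mpoly coef[n]}.

Definition set_last0 n (p : {mpoly coef[n.+1]}) : {mpoly coef[n]} :=
  p \mPo [tuple (if unlift ord_max i is Some j then 'X_j else 0) | i < n.+1].

Definition in_invlim (F : xfamily) : Prop := forall n, set_last0 (F n.+1) = F n.

(* In type D the limit is taken over the even n only, which are cofinal. *)
Definition is_GX (X : ctype) (la : seq nat) (F : xfamily) : Prop :=
  in_invlim F /\
  forall n, (size la <= n)%N -> (X = tD -> ~~ odd n) ->
    FracField.tofrac (F n) = GX_level X la n.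

(* The element of the inverse limit determined by its finite levels. *)
Definition GX (X : ctype) (la : seq nat) : xfamily :=
  epsilon (inhabits (fun n => 0)) (is_GX X la).

(* Simple indices: nd i is i, hat1 is \hat 1. *)
Inductive node := hat1 | nd of nat.

Definition simple_index (X : ctype) (i : node) : bool :=
  match X, i with
  | (tB | tC), nd _ => true
  | tD, hat1 => true
  | tD, nd k => (0 < k)%N
  | _, _ => false
  end.

(* phi(x_1, x_2, ...) |-> phi(b_1, x_1, x_2, ...), twisted by sigma0 on the
   coefficients; the level n of the result comes from the level n + 1 of F. *)
Definition s0 (F : xfamily) : xfamily := fun n =>
  map_mpoly sigma0 (F n.+1) \mPo
    [tuple (if unlift ord0 i is Some j then 'X_j else (b 1)%:MP) | i < n.+1].

Definition s_pos (i : nat) (F : xfamily) : xfamily :=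
  fun n => map_mpoly (sigma i) (F n).

Definition sop (i : node) (F : xfamily) : xfamily :=
  match i with
  | nd 0 => s0 F
  | nd k => s_pos k F
  | hat1 => s0 (s_pos 1 (s0 F))
  end.

(* The value 0 is only taken outside of simple_index X. *)
Definition eroot (X : ctype) (i : node) : coef :=
  match X, i with
  | tB, nd 0 => b 1
  | tC, nd 0 => b 1 (+)_beta b 1
  | tD, hat1 => b 1 (+)_beta b 2
  | _, nd (k.+1) => b k.+2 (-)_beta b k.+1
  | _, _ => 0
  end.

Definition ddiff (X : ctype) (i : node) (F : xfamily) : xfamily := fun n =>
  (eroot X i)^-1 *: (sop i F n - (1 + beta * eroot X i) *: F n).

(* Boxes (i, j) are 1-based. *)
Definition shdiagram (la : seq nat) : pred (nat * nat) :=
  [pred a : nat * nat | [&& (1 <= a.1 <= size la)%N, (a.1 <= a.2)%N &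
    (a.2 <= nth 0%N la a.1.-1 + a.1 - 1)%N]].

Definition content (X : ctype) (a : nat * nat) : node :=
  match X with
  | tB | tC => nd (a.2 - a.1)
  | tD => if (a.1 < a.2)%N then nd (a.2 - a.1 + 1)
          else if odd a.1 then hat1 else nd 1
  end.

(* la is i-removable, with mu = la^(i) *)
Definition removal (X : ctype) (i : node) (la mu : seq nat) : Prop :=
  exists a : nat * nat,
    [/\ a \in shdiagram la, content X a = i, strict_partition mu &
        shdiagram mu =i [predD1 shdiagram la & a]].

Definition removable (X : ctype) (i : node) (la : seq nat) : Prop :=
  exists mu, removal X i la mu.

(* Main.v *)
From HB Require Import structures.
From mathcomp Require Import all_boot all_order all_algebra perm fingroup.
From mathcomp Require Import finmap generic_quotient.
From mathcomp Require Import -(notations) monalg.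
From mathcomp Require Import mpoly ring zify.
From Stdlib Require Import ClassicalEpsilon FunctionalExtensionality.
Require Import Defs.

(** Expanding the symmetrization row by row turns the level [n] of [GX] into an
    iterated sum over distinct points, which can be evaluated at any tuple of
    distinct points of a field; it is a polynomial because an antisymmetric
    polynomial is divisible by the Vandermonde product. Write [X = 1 + beta x] and
    [R x y = (x (+) y) / (x (-) y)].

    For [i >= 1], exchanging [b_i] and [b_(i+1)] only affects the row whose last
    factor is [x (+) b_i], and this factor becomes [(1 + beta e) (x (+) b_i) + e].
    So [pi_i] shortens that row by one box; if the next row already has that
    length, antisymmetry of [R x y * (1 + beta (x (+) c))] identifies the result
    with [- beta GX].

    For [s_0] and [s_hat1], the added points [b_1], [b_2] annihilate all rows of
    length at least 2, while [(x (-) b) * R x b = x (+) b] restores the original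
    parameters. Only a last row of length 1 remains: it contributes
    [sum_a X_a^k prod_(y <> a) R a y] for [k = 0, 1, 2], and these sums are
    evaluated by Lagrange interpolation at the nodes [X_a], [0], [1], [-1].

    Stability in type D follows from [R x t * R x (-)t = 1] and [R t (-)t = 0] by
    letting [t] tend to [0]. *)

Set Implicit Arguments.
Unset Strict Implicit.
Unset Printing Implicit Defensive.

(** * Removable boxes *)

(** The operator [s0] changes both the coefficients and the number of variables, and [GX] is only
    given by a choice operator. Both difficulties disappear once a level is characterised by its
    values, for every embedding of the coefficients into a field, at all tuples of distinct points:
    a reflection becomes a change of embedding together with added points, and the recursion is
    checked at the variables themselves, over their fraction field. This requires the substitutions
    to be field morphisms, hence injective. In type D only the even levels are symmetrizations;
    $s_{\hat1}$ adds two points, and a family is determined by its large even levels. The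
    interpolation nodes come from $R x y = X_y (X_x X_y - 1)/(X_x - X_y)$. The numerators for $y \ne
    a$ are the factors of $\prod_y (X_y z - 1)$ at $z = X_a$, up to the factor $X_a^2 - 1$ of $y =
    a$, which the nodes 1 and -1 cancel. The factors $X_y$ multiply to $\prod X / X_a$, so for $k =
    0$ the summand has a pole at 0, and 0 becomes a node. *)

Section Diagrams.
Implicit Types (la mu : seq nat).

Lemma strict_partitionE la :
  strict_partition la = pairwise gtn la && (0 \notin la).
Proof.
rewrite /strict_partition sorted_pairwise // => y x z /= xy yz.
exact: ltn_trans yz xy.
Qed.

Lemma strict_cat la1 l la2 : strict_partition (la1 ++ l :: la2) =
  [&& all (gtn^~ l) la1, all (gtn l) la2, 0 < l &
     strict_partition la1 && strict_partition la2 && allrel gtn la1 la2].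
Proof.
rewrite !strict_partitionE pairwise_cat allrel_consr /= mem_cat inE !negb_or.
rewrite [0 == l]eq_sym -lt0n.
rewrite -!andbA; do ?[case: (all _ _) => //=]; do ?[case: (pairwise _ _) => //=];
by case: (allrel _ _ _); case: (0 < l); case: (0 \in la1);
  rewrite ?andbF ?andbT.
Qed.

(** An absent row reads as a row of length 0, for which [i <= j < i] is impossible, so the bound on
    the number of rows disappears. *)
Lemma shdiagramE la i j : strict_partition la ->
  ((i, j) \in shdiagram la) = [&& 0 < i, i <= j & j < i + nth 0 la i.-1].
Proof.
case/andP => _ la0; rewrite inE /=.
have [iz|isz] := leqP i (size la); last by rewrite nth_default; lia.
have [->//|i0] := posnP i.
have : nth 0 la i.-1 \in la by rewrite mem_nth // prednK.
have [->|] := eqVneq (nth 0 la i.-1) 0; [by rewrite (negPf la0) | lia].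
Qed.

Lemma eq_from_nth0 la mu : 0 \notin la -> 0 \notin mu ->
  (forall k, nth 0 la k = nth 0 mu k) -> la = mu.
Proof.
have aux s t : 0 \notin t -> (forall k, nth 0 s k = nth 0 t k) ->
    size t <= size s.
  move=> t0 e; rewrite leqNgt; apply: contra t0 => lt.
  by have := e (size s); rewrite nth_default // => ->; exact: mem_nth.
move=> la0 mu0 e; apply: (@eq_from_nth _ 0) => //.
by apply/eqP; rewrite eqn_leq !aux.
Qed.

(** A row of length 1 has to be erased, since a strict partition has no part 0; by [strict_last1] it
    is the last row, so [la2] is then empty. *)
Definition drop_box la1 l la2 : seq nat :=
  if l == 1 then la1 else la1 ++ l.-1 :: la2.

Lemma strict_last1 la1 la2 : strict_partition (la1 ++ 1 :: la2) -> la2 = [::].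
Proof.
rewrite strict_cat => /and4P[_ + _ /andP[/andP[_ /andP[_]]]].
by case: la2 => // -[|k] s.
Qed.

Lemma nth_drop_box la1 l la2 k : strict_partition (la1 ++ l :: la2) ->
  nth 0 (drop_box la1 l la2) k =
    if k == size la1 then l.-1 else nth 0 (la1 ++ l :: la2) k.
Proof.
move=> st; rewrite /drop_box; have [e|_] := eqVneq l 1.
  move: st; rewrite e => /strict_last1 ->; rewrite nth_cat.
  have [lt|gt|->] := ltngtP k (size la1).
  - by [].
  - rewrite nth_default 1?ltnW //.
    by case: (k - _) (subn_gt0 (size la1) k) => [|[]] //; rewrite gt.
  - by rewrite nth_default.
rewrite !nth_cat; have [lt|gt|->] := ltngtP k (size la1) => //.
  by case: (k - _) (subn_gt0 (size la1) k) => //; rewrite gt.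
by rewrite subnn.
Qed.

Lemma removal_shape X i la mu : strict_partition la -> removal X i la mu ->
  exists la1 l la2, [/\ la = la1 ++ l :: la2, mu = drop_box la1 l la2 &
    i = content X ((size la1).+1, size la1 + l)].
Proof.
move=> st [[p q] [ain <- stm diag]].
move: ain; rewrite shdiagramE // => /and3P[p0 pq qla].
case: p p0 pq qla diag => //= k0 _ pq qla diag.
have H k j : (k < j < k.+1 + nth 0 mu k) =
    ~~ ((k == k0) && (j == q)) && (k < j < k.+1 + nth 0 la k).
  by have := diag (k.+1, j); rewrite [RHS]inE /= !shdiagramE //= xpair_eqE eqSS.
have k0la : k0 < size la.
  by rewrite ltnNge; apply/negP => sz; move: qla; rewrite nth_default //; lia.
(* Testing the two diagrams at the last box of each row and just beyond it determines all the row
   lengths of [mu]. *)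
have muE k : nth 0 mu k = if k == k0 then (nth 0 la k0).-1 else nth 0 la k.
  have := H k (k.+1 + nth 0 mu k); have := H k (k.+1 + nth 0 la k).
  have := H k (k + nth 0 la k); have := H k (k + nth 0 la k).-1.
  have := H k (k + nth 0 mu k); have := H k q.
  have [->|kk] := eqVneq k k0; rewrite /= ?andbT; lia.
have qE : q = k0 + nth 0 la k0.
  have := H k0 (k0 + nth 0 la k0); rewrite muE eqxx /=; lia.
have laE : la = take k0 la ++ nth 0 la k0 :: drop k0.+1 la.
  by rewrite -drop_nth // cat_take_drop.
have sz1 : size (take k0 la) = k0 by rewrite size_takel // ltnW.
exists (take k0 la), (nth 0 la k0), (drop k0.+1 la); split=> //.
  have st' := st; rewrite laE in st'.
  apply: eq_from_nth0; first by case/andP: stm.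
    rewrite /drop_box; move: st'; rewrite strict_cat => /and4P[_ _ l0].
    case/andP => /andP[/andP[_ s1] /andP[_ s2]] _.
    case: eqP => // l1; rewrite mem_cat inE !negb_or s1 s2 andbT /=; lia.
  by move=> k; rewrite nth_drop_box // sz1 -laE muE.
by rewrite sz1 qE.
Qed.

Lemma removal_intro X la1 l la2 :
  strict_partition (la1 ++ l :: la2) -> strict_partition (drop_box la1 l la2) ->
  removable X (content X ((size la1).+1, size la1 + l)) (la1 ++ l :: la2).
Proof.
move=> st stm; exists (drop_box la1 l la2), ((size la1).+1, size la1 + l).
have l0 : 0 < l by move: st; rewrite strict_cat => /and4P[].
have nl : nth 0 (la1 ++ l :: la2) (size la1) = l by rewrite nth_cat ltnn subnn.
split=> // [|[i j]]; first by rewrite shdiagramE //= nl; lia.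
rewrite [RHS]inE /= !shdiagramE // nth_drop_box // xpair_eqE.
case: i => [|i] //=.
by rewrite eqSS; have [->|//] := eqVneq i (size la1); rewrite nl; lia.
Qed.

Lemma strict_split la l : strict_partition la -> l \in la ->
  exists la1 la2, [/\ la = la1 ++ l :: la2, l \notin la1 & l \notin la2].
Proof.
move=> st lla; have laE := cat_take_drop (index l la) la.
rewrite (drop_nth 0) ?index_mem // nth_index // in laE.
exists (take (index l la) la), (drop (index l la).+1 la); split=> //.
  move: st; rewrite -{1}laE strict_cat => /and4P[/allP h _ _ _].
  by apply/negP => /h /=; rewrite ltnn.
move: st; rewrite -{1}laE strict_cat => /and4P[_ /allP h _ _].
by apply/negP => /h /=; rewrite ltnn.
Qed.

(** Decreasing a part by one keeps the partition strict unless the next part already has that value.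
    This obstruction produces the two equal rows treated by [GXsum_equal_parts]. *)
Lemma not_removable_next X la1 l la2 : 1 < l ->
  strict_partition (la1 ++ l :: la2) ->
  ~ removable X (content X ((size la1).+1, size la1 + l)) (la1 ++ l :: la2) ->
  exists la3, la2 = l.-1 :: la3.
Proof.
move=> l1 st nrem.
have [hd|hd] := eqVneq (ohead la2) (Some l.-1).
  by case: la2 hd {st nrem} => // x la3 [->]; exists la3.
case: nrem; apply: removal_intro => //; rewrite /drop_box gtn_eqF //.
move: st; rewrite !strict_cat => /and4P[h1 h2 _ h3]; apply/and4P; split=> //.
- by apply/allP => x /(allP h1) /=; lia.
- case: la2 hd h2 h3 => // x la2 /eqP hd /= /andP[xl _].
  case/andP => /andP[_]; rewrite strict_partitionE => /andP[/=].
  case/andP => /allP hx _ _ _; have xl1 : x < l.-1.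
    by have : x <> l.-1 by [move=> e; apply: hd; rewrite e]; lia.
  by rewrite xl1; apply/allP => y /hx /=; lia.
- by lia.
Qed.

Lemma strict_part1 la : strict_partition la -> 1 \in la ->
  exists la1, [/\ la = la1 ++ [:: 1], forall l, l \in la1 -> 1 < l &
    strict_partition la1].
Proof.
move=> st /(strict_split st)[la1 [la2 [e _ _]]]; rewrite e in st.
have e2 := strict_last1 st; exists la1; rewrite e e2; split=> //.
  by move: st; rewrite strict_cat => /and4P[/allP].
by move: st; rewrite strict_cat => /and4P[_ _ _ /andP[/andP[]]].
Qed.

Lemma strict_no1 la : strict_partition la -> 1 \notin la ->
  forall l, l \in la -> 1 < l.
Proof.
case/andP => _ n0 n1 l lla; rewrite ltn_neqAle lt0n.
by apply/andP; split; [apply: contraNneq n1 => -> | apply: contraNneq n0 => <-].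
Qed.

(** The last box of row [s.+1] is off the diagonal, where type D contents are shifted by one: the
    node [nd k.+1] acts on rows of length [k.+1] in type D, and [k.+2] in types B and C. *)
Lemma content_gt1 X s l : 1 < l ->
  content X (s.+1, s + l) = nd (if X is tD then l else l.-1).
Proof.
move=> l1; rewrite /content /=; case: X; rewrite ?ifT; try (congr nd); lia.
Qed.

Lemma content_1 X s :
  content X (s.+1, s + 1) = if X is tD then if odd s then nd 1 else hat1 else nd 0.
Proof.
by rewrite /content addn1 ltnn subnn; case: X => //=; case: odd.
Qed.

Lemma strict_prefix la1 la2 : strict_partition (la1 ++ la2) -> strict_partition la1.
Proof.
rewrite !strict_partitionE pairwise_cat mem_cat negb_or.
by case/andP => /and3P[_ -> _] /andP[->].
Qed.

End Diagrams.

Import GRing.Theory.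
Local Open Scope ring_scope.

(** * Row expansions *)

Section RowExpansion.
Variables (L : fieldType) (bt : L).

Definition xratio (x y : L) : L := (x (+)_bt y) / (x (-)_bt y).

(* Expansion of the symmetrization along the rows of [la]: each row picks one
   of the remaining points; [tl] is evaluated at the points left over. *)
Fixpoint rowsum (g : nat -> L -> L) (tl : seq L -> L) (la : seq nat)
    (xs : seq L) : L :=
  if la is l :: la' then
    \sum_(a <- xs) g l a * (\prod_(y <- rem a xs) xratio a y) *
      rowsum g tl la' (rem a xs)
  else tl xs.

Definition last_sum (h : L -> L) (xs : seq L) : L :=
  \sum_(a <- xs) h a * \prod_(y <- rem a xs) xratio a y.

Implicit Types (g : nat -> L -> L) (tl : seq L -> L) (la : seq nat).

Lemma perm_rem (T : eqType) (a : T) (s t : seq T) :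
  perm_eq s t -> perm_eq (rem a s) (rem a t).
Proof.
move=> st; apply/seq.permP => p; rewrite !count_rem (seq.permP st).
by rewrite (perm_mem st).
Qed.

(** The tails are compared only on lists of the size left after all rows have picked a point: the
    sums over a last row depend on the parity of that size. *)
Lemma eq_rowsum g g' tl tl' la xs :
  (forall l x, l \in la -> x \in xs -> g l x = g' l x) ->
  (forall ys, uniq ys -> {subset ys <= xs} ->
     (size ys + size la)%N = size xs -> tl ys = tl' ys) ->
  uniq xs -> (size la <= size xs)%N ->
  rowsum g tl la xs = rowsum g' tl' la xs.
Proof.
elim: la xs => [|l la IH] xs eg et uxs sz /=.
  by apply: et => //; rewrite addn0.
rewrite big_seq [RHS]big_seq; apply: eq_bigr => a axs.
rewrite eg ?mem_head //; congr (_ * _).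
have szr : size xs = (size (rem a xs)).+1.
  by rewrite size_rem // prednK //; case: (xs) axs.
apply: IH => [k x kla xxs|ys uys sub szy||].
- by apply: eg; [rewrite inE kla orbT | exact: mem_rem xxs].
- apply: et => // [y /sub/mem_rem //|].
  by rewrite szr /= addnS szy.
- exact: rem_uniq.
- by move: sz; rewrite szr.
Qed.

Lemma rowsum_cat g tl la1 la2 xs :
  rowsum g tl (la1 ++ la2) xs = rowsum g (rowsum g tl la2) la1 xs.
Proof.
elim: la1 xs => //= l la1 IH xs; apply: eq_bigr => a _; by rewrite IH.
Qed.

Lemma rowsum_lin g tl tl1 tl2 (u v : L) la xs :
  (forall ys, tl ys = u * tl1 ys + v * tl2 ys) ->
  rowsum g tl la xs = u * rowsum g tl1 la xs + v * rowsum g tl2 la xs.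
Proof.
move=> e; elim: la xs => //= l la IH xs; rewrite !big_distrr -big_split /=.
by apply: eq_bigr => a _; rewrite IH; ring.
Qed.

(** The lengths [l1] and [l2] are independent of [l], so that one of the two terms may have a
    shorter first row. *)
Lemma rowsum_head_lin g g1 g2 tl tl' (u v : L) l l1 l2 la la' xs :
  (forall x, x \in xs -> g l x = u * g1 l1 x + v * g2 l2 x) ->
  (forall ys, rowsum g tl la ys = rowsum g1 tl' la' ys) ->
  (forall ys, rowsum g tl la ys = rowsum g2 tl' la' ys) ->
  rowsum g tl (l :: la) xs =
    u * rowsum g1 tl' (l1 :: la') xs + v * rowsum g2 tl' (l2 :: la') xs.
Proof.
move=> e e1 e2; rewrite /= !big_distrr -big_split /=.
rewrite big_seq [RHS]big_seq; apply: eq_bigr => a ax.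
by rewrite -e1 -e2 e //; ring.
Qed.

Lemma perm_rowsum g tl la xs xs' :
  (forall ys ys', perm_eq ys ys' -> tl ys = tl ys') ->
  perm_eq xs xs' -> rowsum g tl la xs = rowsum g tl la xs'.
Proof.
move=> et; elim: la xs xs' => [|l la IH] xs xs' pxs /=; first exact: et.
rewrite (perm_big _ pxs) /=; apply: eq_bigr => a _.
by rewrite (perm_big _ (perm_rem a pxs)) (IH _ _ (perm_rem a pxs)).
Qed.

Lemma rowsum_rcons g tl l la xs :
  (forall ys, tl ys = 1) ->
  rowsum g tl (rcons la l) xs = rowsum g (last_sum (g l)) la xs.
Proof.
move=> e; elim: la xs => [|k la IH] xs /=.
  by apply: eq_bigr => a _; rewrite e mulr1.
by apply: eq_bigr => a _; rewrite IH.
Qed.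

(** No row can pick [y], because every row factor vanishes there. So [y] survives into the tail, and
    its only other effect is to multiply the factor of each picked point [x] by [xratio x y]. *)
Lemma rowsum_add_point g g' tl tl' la y xs :
  y \notin xs -> uniq xs -> (size la <= size xs)%N ->
  (forall l, l \in la -> g' l y = 0) ->
  (forall l x, l \in la -> x \in xs -> g' l x * xratio x y = g l x) ->
  (forall ys, uniq ys -> {subset ys <= xs} ->
     (size ys + size la)%N = size xs -> tl' (y :: ys) = tl ys) ->
  rowsum g' tl' la (y :: xs) = rowsum g tl la xs.
Proof.
elim: la xs => [|l la IH] xs yxs uxs sz g0 gx et /=.
  by apply: et => //; rewrite addn0.
rewrite big_cons g0 ?mem_head // !mul0r add0r.
rewrite big_seq [RHS]big_seq; apply: eq_bigr => a axs.
have /negPf-> : y != a by apply: contraNneq yxs => ->.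
have szr : size xs = (size (rem a xs)).+1.
  by rewrite size_rem // prednK //; case: (xs) axs.
rewrite big_cons IH => [||||k kla|k x kla xxs|ys uys sub szy].
- by rewrite -(gx l a) ?mem_head //; ring.
- by apply: contra yxs; exact: mem_rem.
- exact: rem_uniq.
- by move: sz; rewrite szr.
- by apply: g0; rewrite inE kla orbT.
- by apply: gx; [rewrite inE kla orbT | exact: mem_rem xxs].
- by apply: et => // [z /sub/mem_rem //|]; rewrite szr /= addnS szy.
Qed.

(** A row that picks [t] or [t'] still has the other one among its remaining points, hence carries a
    zero ratio; a row that picks another point sees the product of its two new ratios, which is
    1. *)
Lemma rowsum_add_opposite g tl tl' la t t' xs :
  t != t' -> t \notin xs -> t' \notin xs ->
  xratio t t' = 0 -> xratio t' t = 0 ->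
  (forall x, x \in xs -> xratio x t * xratio x t' = 1) ->
  (forall ys, tl' [:: t, t' & ys] = tl ys) ->
  rowsum g tl' la [:: t, t' & xs] = rowsum g tl la xs.
Proof.
move=> tt' + + rt rt' + et; elim: la xs => [|l la IH] xs txs txs' rx //=.
rewrite !big_cons eqxx (negPf tt') !big_cons rt rt' !(mul0r, mulr0) !add0r.
rewrite big_seq [RHS]big_seq; apply: eq_bigr => a axs.
have /negPf-> : t != a by apply: contraNneq txs => ->.
have /negPf-> : t' != a by apply: contraNneq txs' => ->.
rewrite !big_cons [xratio a t * _]mulrA rx // mul1r IH //.
- by apply: contra txs; exact: mem_rem.
- by apply: contra txs'; exact: mem_rem.
- by move=> x /mem_rem; exact: rx.
Qed.

Lemma eq_rowsum_fun g g' tl la xs :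
  (forall l x, l \in la -> g l x = g' l x) ->
  rowsum g tl la xs = rowsum g' tl la xs.
Proof.
elim: la xs => //= l la IH xs e; apply: eq_bigr => a _.
by rewrite e ?mem_head // IH // => k x kla; apply: e; rewrite inE kla orbT.
Qed.

Lemma xratioE x y : xratio x y = (x (+)_bt y) * (1 + bt * y) / (x - y).
Proof. by rewrite /xratio /ominus invf_div mulrA. Qed.

Lemma sum_antisym (f : L -> L -> L) xs :
  (2 : L) != 0 -> uniq xs ->
  (forall x y, x \in xs -> y \in xs -> x != y -> f x y = - f y x) ->
  \sum_(x <- xs) \sum_(y <- rem x xs) f x y = 0.
Proof.
move=> nz2 uxs fN; set s := LHS.
have sE : s = \sum_(x <- xs) \sum_(y <- xs | y != x) f x y.
  by apply: eq_bigr => x _; rewrite rem_filter // big_filter.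
have : s = - s.
  rewrite {1}sE (exchange_big_dep predT) //= sE -sumrN big_seq [RHS]big_seq.
  apply: eq_bigr => y yxs; rewrite -sumrN big_seq_cond [RHS]big_seq_cond.
  apply: eq_big => [x|x /andP[xxs xy]]; first by rewrite eq_sym.
  by rewrite fN // eq_sym.
move/eqP; rewrite -subr_eq0 opprK -mulr2n -mulr_natl mulf_eq0 (negPf nz2).
by move/eqP.
Qed.

(** The difference of the two sides carries the factor [1 + bt * (x (+) c)], which is $X_x X_c$, and
    $R x y \, X_x = X_x X_y (X_x X_y - 1)/(X_x - X_y)$ changes sign when $x$ and $y$ are
    exchanged. *)
Lemma rowsum_equal_parts g tl la (c : L) l l' k xs :
  (2 : L) != 0 -> uniq xs ->
  (forall x, x \in xs -> g l x = g l' x) ->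
  (forall x, x \in xs -> g k x = g l' x * (x (+)_bt c)) ->
  rowsum g tl [:: l, l' & la] xs = - bt * rowsum g tl [:: k, l' & la] xs.
Proof.
move=> nz2 uxs gl gk; apply/eqP; rewrite mulNr -subr_eq0 opprK; apply/eqP.
rewrite /= big_distrr -big_split /=.
(* [w] collects everything that is symmetric in the points picked by the first two rows. *)
pose w x y := g l' x * g l' y * (\prod_(z <- rem y (rem x xs)) xratio x z) *
  (\prod_(z <- rem y (rem x xs)) xratio y z) *
  rowsum g tl la (rem y (rem x xs)).
have wC x y : w x y = w y x.
  rewrite /w !rem_filter // ?filter_uniq // -!filter_predI.
  have -> : [seq z <- xs | predI (predC1 y) (predC1 x) z] =
            [seq z <- xs | predI (predC1 x) (predC1 y) z].
    by apply: eq_filter => z /=; rewrite andbC.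
  by ring.
rewrite -[RHS](@sum_antisym
  (fun x y => xratio x y * (1 + bt * (x (+)_bt c)) * w x y) xs nz2 uxs).
  rewrite big_seq [RHS]big_seq; apply: eq_bigr => x xxs.
  rewrite !mulr_sumr -big_split /= big_seq [RHS]big_seq; apply: eq_bigr => y yxs.
  rewrite (perm_big _ (perm_to_rem yxs)) big_cons /= /w gl // gk //.
  by ring.
move=> x y xxs yxs xy; rewrite [w y x]wC -mulNr; congr (_ * _).
by rewrite !xratioE /oplus; field; rewrite !subr_eq0 xy eq_sym xy.
Qed.

(** Compare the coefficients of the top degree in Lagrange's interpolation formula for [p]: each
    basis product is monic of that degree. *)
Lemma lagrange_coef (zs : seq L) (p : {poly L}) :
  uniq zs -> (size p <= size zs)%N ->
  \sum_(z <- zs) p.[z] / \prod_(y <- rem z zs) (z - y) = p`_(size zs).-1.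
Proof.
move=> uzs szp.
pose c z := p.[z] / \prod_(y <- rem z zs) (z - y).
pose q := \sum_(z <- zs) c z *: \prod_(y <- rem z zs) ('X - y%:P).
have szr z : z \in zs -> size (\prod_(y <- rem z zs) ('X - y%:P)) = size zs.
  by move=> zz; rewrite size_prod_XsubC size_rem // prednK //; case: (zs) zz.
have szq : (size q <= size zs)%N.
  rewrite /q big_seq; apply: (big_ind (fun r : {poly L} => size r <= size zs)%N).
  - by rewrite size_poly0.
  - by move=> r s hr hs; rewrite (leq_trans (size_polyD _ _)) // geq_max hr.
  - by move=> z zz; rewrite (leq_trans (size_scale_leq _ _)) // szr.
have qp : q = p.
  apply/eqP; rewrite -subr_eq0; apply/eqP.
  apply: (@roots_geq_poly_eq0 _ _ zs) => //.
    apply/allP => w wz; rewrite /root hornerD hornerN subr_eq0; apply/eqP.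
    rewrite /q horner_sum (bigD1_seq w) //= [X in _ + X]big_seq_cond.
    rewrite [X in _ + X]big1 => [|z].
      rewrite addr0 hornerZ horner_prod /c.
      under [X in _ * X]eq_bigr do rewrite hornerXsubC.
      rewrite divfK // prodf_seq_neq0; apply/allP => y.
      by rewrite mem_rem_uniq // inE subr_eq0 eq_sym => /andP[].
    move=> /andP[zz zw]; rewrite hornerZ horner_prod (bigD1_seq w) /=.
    - by rewrite hornerXsubC subrr mul0r mulr0.
    - by rewrite mem_rem_uniq // inE eq_sym zw.
    - exact: rem_uniq.
  rewrite (leq_trans (size_polyD _ _)) // geq_max szq size_polyN.
  exact: szp.
rewrite -[in RHS]qp /q coef_sum big_seq [RHS]big_seq; apply: eq_bigr => z zz.
rewrite coefZ -{1}(szr z zz) -/(lead_coef _).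
by have /eqP-> := monic_prod_XsubC (rem z zs) predT id; rewrite mulr1.
Qed.

(** * Sums over a last row, by Lagrange interpolation *)

Section LastRow.
Hypotheses (nz2 : (2 : L) != 0) (nzbt : bt != 0).

(** The three conditions say that [1 + bt * x] differs from 1, 0 and -1 respectively, which keeps
    the extra interpolation nodes away from it. *)
Definition gpoint (x : L) :=
  [&& x != 0, 1 + bt * x != 0 & 2 + bt * x != 0].

Let E (x : L) : L := 1 + bt * x.

Let prodE (xs : seq L) : L := \prod_(x <- xs) E x.

Let E_inj : injective E.
Proof. by move=> x y /addrI/(mulfI nzbt). Qed.

Let prodE_neq0 xs : all gpoint xs -> prodE xs != 0.
Proof.
move=> gxs; rewrite prodf_seq_neq0; apply/allP => x /(allP gxs).
by case/and3P.
Qed.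

Let rem_map (x : L) xs : uniq xs -> rem (E x) (map E xs) = map E (rem x xs).
Proof.
move=> uxs; rewrite !rem_filter ?map_inj_uniq // filter_map; congr map.
by apply: eq_filter => y /=; rewrite (inj_eq E_inj).
Qed.

Let p (xs : seq L) : {poly L} := \prod_(x <- xs) ((E x)%:P * 'X - 1).

Let size_fac x : gpoint x -> size ((E x)%:P * 'X - 1) = 2%N.
Proof.
case/and3P => _ nz _; rewrite size_polyDl mul_polyC size_scale ?size_polyX //.
by rewrite size_polyN size_poly1.
Qed.

Let size_p xs : all gpoint xs -> size (p xs) = (size xs).+1.
Proof.
elim: xs => [|x xs IH] /=; first by rewrite /p big_nil size_poly1.
case/andP => gx gxs; rewrite /p big_cons -/(p xs) size_mul ?IH ?size_fac //.
  by rewrite -size_poly_gt0 size_fac.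
by rewrite -size_poly_gt0 IH.
Qed.

Let lead_p xs : all gpoint xs -> lead_coef (p xs) = prodE xs.
Proof.
elim: xs => [|x xs IH] /=; first by rewrite /p /prodE !big_nil lead_coef1.
case/andP => gx gxs; rewrite /p /prodE !big_cons lead_coefM -/(p xs) IH //.
rewrite lead_coefDl; last first.
  rewrite size_polyN size_poly1 mul_polyC size_scale ?size_polyX //.
  by case/and3P: gx.
by rewrite lead_coefM lead_coefC lead_coefX mulr1.
Qed.

Let core (f : L -> L) (zs : seq L) : L :=
  \sum_(z <- zs) f z * \prod_(y <- rem z zs) ((z * y - 1) / (z - y)).

(** The factors $X_y$ of the ratios with $y \ne a$ multiply to [prodE xs] divided by $X_a$, which
    explains the division by [z]. *)
Let last_sumE (h : L -> L) xs : uniq xs -> all gpoint xs ->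
  last_sum (fun x => h (E x)) xs = prodE xs * core (fun z => h z / z) (map E xs).
Proof.
move=> uxs gxs; rewrite /core big_map mulr_sumr /last_sum big_seq [RHS]big_seq.
apply: eq_bigr => a axs; rewrite rem_map // big_map /prodE.
rewrite (perm_big _ (perm_to_rem axs)) big_cons /=.
have -> : \prod_(y <- rem a xs) xratio a y =
    (\prod_(y <- rem a xs) E y) *
    \prod_(y <- rem a xs) ((E a * E y - 1) / (E a - E y)).
  rewrite -big_split big_seq [RHS]big_seq; apply: eq_bigr => y.
  rewrite mem_rem_uniq // inE => /andP[ya yxs].
  rewrite xratioE /oplus /E /=; field.
  rewrite opprD addrACA subrr add0r -mulrBr mulf_eq0 (negPf nzbt) /= subr_eq0.
  by rewrite eq_sym ya.
have := allP gxs a axs => /and3P[_ nz _]; rewrite -/(E a) in nz.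
by field.
Qed.

Let eval_p xs a : a \in xs ->
  (p xs).[E a] = (E a ^+ 2 - 1) * \prod_(y <- rem a xs) (E a * E y - 1).
Proof.
move=> axs; rewrite /p horner_prod (perm_big _ (perm_to_rem axs)) big_cons /=.
rewrite !hornerE expr2; congr (_ * _); apply: eq_bigr => y _.
by rewrite !hornerE mulrC.
Qed.

Let gE xs a : all gpoint xs -> a \in xs ->
  [/\ E a != 0, E a != 1 & E a != -1].
Proof.
move=> gxs /(allP gxs) /and3P[na n1 n2]; split=> //.
  by rewrite -subr_eq0 /E addrC addKr mulf_neq0.
by rewrite -subr_eq0 opprK /E addrAC.
Qed.

Let one_neqN1 : 1 != -1 :> L.
Proof. by rewrite -subr_eq0 opprK. Qed.

Let nodes_uniq xs : uniq xs -> all gpoint xs ->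
  uniq [:: 0, 1, -1 & map E xs].
Proof.
move=> uxs gxs; rewrite !cons_uniq !inE !negb_or map_inj_uniq // uxs one_neqN1.
rewrite [0 == 1]eq_sym oner_eq0 [0 == -1]eq_sym oppr_eq0 oner_eq0 /= andbT.
apply/and3P; split; apply/negP => /mapP[a /(gE gxs)[]];
  by move=> + + + e; rewrite -e eqxx.
Qed.

Let prod_ratio (s : seq L) (f h : L -> L) (c : L) :
  (forall x, x \in s -> h x != 0) -> (forall x, x \in s -> f x = c * h x) ->
  (\prod_(x <- s) f x) / \prod_(x <- s) h x = c ^+ size s.
Proof.
elim: s => [|x s IH] nz e; first by rewrite !big_nil divr1.
rewrite !big_cons invfM mulrACA IH => [|y ys|y ys].
- by rewrite e ?mem_head // mulfK ?nz ?mem_head // exprS.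
- by apply: nz; rewrite inE ys orbT.
- by apply: e; rewrite inE ys orbT.
Qed.

Let p_at1 xs : all gpoint xs ->
  (p xs).[1] / (\prod_(y <- map E xs) (1 - y)) = (-1) ^+ size xs.
Proof.
move=> gxs; rewrite /p horner_prod big_map; apply: prod_ratio => x xs_x.
  by rewrite subr_eq0 eq_sym; case: (gE gxs xs_x).
by rewrite !hornerE; ring.
Qed.

Let p_atN1 xs : all gpoint xs ->
  (p xs).[-1] / (\prod_(y <- map E xs) (-1 - y)) = 1.
Proof.
move=> gxs; rewrite /p horner_prod big_map -[RHS](expr1n _ (size xs)).
apply: prod_ratio => x xs_x.
  by rewrite subr_eq0 eq_sym; case: (gE gxs xs_x).
by rewrite !hornerE; ring.
Qed.

Let p_at0 xs : all gpoint xs ->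
  (p xs).[0] / (\prod_(y <- map E xs) (0 - y)) = (prodE xs)^-1.
Proof.
rewrite /p horner_prod big_map /prodE.
elim: xs => [|x xs IH] /=; first by rewrite !big_nil divr1 invr1.
case/andP => /and3P[_ nz _] /IH {}IH; rewrite !big_cons invfM mulrACA IH invfM.
by congr (_ * _); rewrite !hornerE invrN mulN1r opprK.
Qed.

Let p_node xs a : uniq xs -> all gpoint xs -> a \in xs ->
  (p xs).[E a] / ((E a - 1) * ((E a - -1) *
     \prod_(y <- map E (rem a xs)) (E a - y))) =
  \prod_(y <- map E (rem a xs)) ((E a * y - 1) / (E a - y)).
Proof.
move=> uxs gxs axs; have [n0 n1 nN] := gE gxs axs.
rewrite eval_p // big_split /= prodfV !big_map; field.
have -> : E a + 1 = E a - -1 by rewrite opprK.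
rewrite !subr_eq0 n1 nN !andbT.
rewrite prodf_seq_neq0; apply/allP => y; rewrite mem_rem_uniq // inE.
by rewrite subr_eq0 (inj_eq E_inj) eq_sym => /andP[].
Qed.

(** Interpolation of [q * p xs] at 1, -1 and the [E x]: the terms at the [E x] form [core], and
    those at 1 and -1 are moved to the right. The size bound limits [q] to degree 1. *)
Let core_poly (q : {poly L}) xs : uniq xs -> all gpoint xs ->
  (size (q * p xs)%R <= (size xs).+2)%N ->
  core (horner q) (map E xs) =
    (q * p xs)`_(size xs).+1 - q.[1] * (-1) ^+ size xs / 2 + q.[-1] / 2.
Proof.
move=> uxs gxs szq; have /andP[_ un] := nodes_uniq uxs gxs.
have /andP[_ unN] := un.
have := @lagrange_coef [:: 1, -1 & map E xs] (q * p xs) un.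
rewrite [size (_ :: _)]/= size_map => /(_ szq) /= <-.
rewrite !big_cons eqxx (negPf one_neqN1) eqxx !big_cons !hornerM.
have -> : q.[1] * (p xs).[1] / ((1 - -1) * \prod_(j <- map E xs) (1 - j)) =
    q.[1] * (-1) ^+ size xs / 2.
  by rewrite -(p_at1 gxs) invfM opprK; ring.
have -> : q.[-1] * (p xs).[-1] / ((-1 - 1) * \prod_(j <- map E xs) (-1 - j)) =
    - (q.[-1] / 2).
  have -> : -1 - 1 = -2 :> L by ring.
  by rewrite invfM mulrACA p_atN1 // mulr1 invrN mulrN.
set u := q.[1] * _ / 2; set w := q.[-1] / 2.
have -> t : u + (- w + t) - u + w = t by ring.
rewrite /core !big_map big_seq [RHS]big_seq; apply: eq_bigr => a axs.
have /negPf-> : 1 != E a by rewrite eq_sym; case: (gE gxs axs).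
have /negPf-> : -1 != E a by rewrite eq_sym; case: (gE gxs axs).
by rewrite !big_cons hornerM rem_map // -mulrA p_node.
Qed.

Let sign_half (m : nat) :
  (1 + (-1) ^+ m) / 2 = (~~ odd m)%:R :> L.
Proof.
by rewrite -signr_odd; case: odd; rewrite ?expr1 ?subrr ?mul0r // expr0 divff.
Qed.

Let core_one xs : uniq xs -> all gpoint xs ->
  core (fun=> 1) (map E xs) = (odd (size xs))%:R.
Proof.
move=> uxs gxs.
have -> : core (fun=> 1) (map E xs) = core (horner 1) (map E xs).
  by apply: eq_bigr => z _; rewrite hornerC.
rewrite core_poly // mul1r ?size_p // !hornerC nth_default ?size_p //.
by rewrite -signr_odd; case: odd; rewrite ?expr1 ?expr0 /=; field.
Qed.

Let core_id xs : uniq xs -> all gpoint xs ->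
  core id (map E xs) = prodE xs - (~~ odd (size xs))%:R.
Proof.
move=> uxs gxs.
have -> : core id (map E xs) = core (horner 'X) (map E xs).
  by apply: eq_bigr => z _; rewrite hornerX.
have nzp : p xs != 0 by rewrite -size_poly_gt0 size_p.
rewrite core_poly //; last by rewrite mulrC size_mulX // size_p.
rewrite !hornerX coefXM /= -(lead_p gxs) lead_coefE size_p // -sign_half.
by field.
Qed.

(** The node 0 supplies the factor [z^-1] in the terms at the [E x]. With three extra nodes the
    degree of [p xs] is below the top one, so all the interpolation terms add up to 0. *)
Let core_inv xs : uniq xs -> all gpoint xs ->
  core (fun z => z^-1) (map E xs) = (prodE xs)^-1 - (~~ odd (size xs))%:R.
Proof.
move=> uxs gxs; have un := nodes_uniq uxs gxs.
have := @lagrange_coef [:: 0, 1, -1 & map E xs] (p xs) un.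
rewrite [size (_ :: _)]/= size_map size_p // ltnW // => /(_ isT).
rewrite [(p xs)`_ _]nth_default ?size_p // => /eqP.
have [n01 n0N] : 0 != 1 :> L /\ 0 != -1 :> L.
  by rewrite ![0 == _]eq_sym oppr_eq0 oner_eq0.
rewrite /= !big_cons !eqxx (negPf n01) (negPf n0N) (negPf one_neqN1) !big_cons.
have -> : (p xs).[0] / ((0 - 1) * ((0 - -1) * \prod_(j <- map E xs) (0 - j))) =
    - (prodE xs)^-1.
  by rewrite -(p_at0 gxs) !invfM !sub0r opprK invrN invr1; ring.
have -> : (p xs).[1] / ((1 - 0) * ((1 - -1) * \prod_(j <- map E xs) (1 - j))) =
    (-1) ^+ size xs / 2.
  by rewrite -(p_at1 gxs) !invfM opprK subr0 invr1; ring.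
have -> : (p xs).[-1] / ((-1 - 0) * ((-1 - 1) * \prod_(j <- map E xs) (-1 - j)))
    = 1 / 2.
  have -> : -1 - 1 = -2 :> L by ring.
  rewrite !invfM [_^-1 * (_ * _)]mulrA mulrCA p_atN1 // subr0 !invrN invr1.
  by ring.
rewrite addrA addrA -sign_half addrC addr_eq0 => /eqP e.
have -> : core (fun z => z^-1) (map E xs) =
  - (- (prodE xs)^-1 + (-1) ^+ size xs / 2 + 1 / 2); last by ring.
rewrite -e /core !big_map big_seq [RHS]big_seq; apply: eq_bigr => a axs.
have /negPf-> : 1 != E a by rewrite eq_sym; case: (gE gxs axs).
have /negPf-> : -1 != E a by rewrite eq_sym; case: (gE gxs axs).
have /negPf-> : 0 != E a by rewrite eq_sym; case: (gE gxs axs).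
by rewrite !big_cons rem_map // -p_node // subr0 [in RHS]invfM [RHS]mulrCA.
Qed.

Lemma eq_last_sum (h h' : L -> L) xs :
  (forall x, x \in xs -> h x = h' x) -> last_sum h xs = last_sum h' xs.
Proof.
by move=> e; rewrite /last_sum big_seq [RHS]big_seq; apply: eq_bigr => x /e ->.
Qed.

Lemma last_sum1 xs : uniq xs -> all gpoint xs ->
  last_sum (fun=> 1) xs =
    if odd (size xs) then 1 else 1 - \prod_(x <- xs) (1 + bt * x).
Proof.
move=> uxs gxs; rewrite (last_sumE (fun=> 1)) //.
have -> : core (fun z => 1 / z) (map E xs) = core (fun z => z^-1) (map E xs).
  by apply: eq_bigr => z _; rewrite mul1r.
rewrite core_inv // mulrBr divff ?prodE_neq0 //.
by case: odd; rewrite /= ?mulr0 ?mulr1 ?subr0.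
Qed.

Lemma last_sumX xs : uniq xs -> all gpoint xs ->
  last_sum (fun x => 1 + bt * x) xs =
    if odd (size xs) then \prod_(x <- xs) (1 + bt * x) else 0.
Proof.
move=> uxs gxs; rewrite (last_sumE (fun z => z)) //.
have -> : core (fun z => z / z) (map E xs) = core (fun=> 1) (map E xs).
  rewrite /core !big_map big_seq [RHS]big_seq; apply: eq_bigr => a axs.
  by rewrite divff //; case: (gE gxs axs).
by rewrite core_one //; case: odd; rewrite ?mulr1 ?mulr0.
Qed.

Lemma last_sumX2 xs : uniq xs -> all gpoint xs ->
  last_sum (fun x => (1 + bt * x) ^+ 2) xs =
    if odd (size xs) then (\prod_(x <- xs) (1 + bt * x)) ^+ 2
    else (\prod_(x <- xs) (1 + bt * x)) ^+ 2 - \prod_(x <- xs) (1 + bt * x).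
Proof.
move=> uxs gxs; rewrite (last_sumE (fun z => z ^+ 2)) //.
have -> : core (fun z => z ^+ 2 / z) (map E xs) = core id (map E xs).
  rewrite /core !big_map big_seq [RHS]big_seq; apply: eq_bigr => a axs.
  by rewrite expr2 mulfK //; case: (gE gxs axs).
by rewrite core_id // /prodE /E; case: odd => /=; ring.
Qed.

Lemma last_sum_lin (h h1 h2 : L -> L) (u v : L) xs :
  (forall x, h x = u * h1 x + v * h2 x) ->
  last_sum h xs = u * last_sum h1 xs + v * last_sum h2 xs.
Proof.
move=> e; rewrite /last_sum !mulr_sumr -big_split; apply: eq_bigr => x _ /=.
by rewrite e; ring.
Qed.

(** With $x = (X - 1)/\beta$, the parity-dependent corrections to the sums for $X$ and 1 cancel. The
    same happens for $X^2 - 1$ below, which is why types B and C do not distinguish parities. *)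
Lemma last_sum_id xs : uniq xs -> all gpoint xs ->
  last_sum id xs = (\prod_(x <- xs) (1 + bt * x) - 1) / bt.
Proof.
move=> uxs gxs.
rewrite (@last_sum_lin _ (fun x => 1 + bt * x) (fun=> 1) bt^-1 (- bt^-1)).
  by rewrite last_sum1 // last_sumX //; case: odd; ring.
by move=> x; field.
Qed.

Lemma last_sum_double xs : uniq xs -> all gpoint xs ->
  last_sum (fun x => x (+)_bt x) xs =
    ((\prod_(x <- xs) (1 + bt * x)) ^+ 2 - 1) / bt.
Proof.
move=> uxs gxs.
rewrite (@last_sum_lin _ (fun x => (1 + bt * x) ^+ 2) (fun=> 1) bt^-1 (- bt^-1)).
  by rewrite last_sum1 // last_sumX2 //; case: odd; ring.
by move=> x; rewrite /oplus; field.
Qed.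

(** Here $x \oplus c = (X_c X - 1)/\beta$ and the corrections no longer cancel. The remaining parity
    is what separates the nodes $\hat1$ and 1 of type D on rows of length 1. *)
Lemma last_sum_oplus (c : L) xs : uniq xs -> all gpoint xs ->
  last_sum (fun x => x (+)_bt c) xs =
    ((if odd (size xs) then 1 + bt * c else 1) * \prod_(x <- xs) (1 + bt * x)
      - 1) / bt.
Proof.
move=> uxs gxs.
rewrite (@last_sum_lin _ (fun x => 1 + bt * x) (fun=> 1)
  ((1 + bt * c) / bt) (- bt^-1)).
  by rewrite last_sum1 // last_sumX //; case: odd; ring.
by move=> x; rewrite /oplus; field.
Qed.

End LastRow.

End RowExpansion.

(** * The coefficient field and its substitutions *)

Section EvalBpoly.
Variables (A : comNzRingType) (f : {rmorphism {poly int} -> A}) (v : nat -> A).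

Definition bmonom_eval (m : monalg.cmonom nat) : A :=
  \prod_(k <- finsupp m) v k.+1 ^+ m k.

Lemma bmonom_evalE m (d : {fset nat}) :
  (finsupp (m : monalg.cmonom nat) `<=` d)%fset ->
  bmonom_eval m = \prod_(k <- d) v k.+1 ^+ m k.
Proof.
move=> md; rewrite /bmonom_eval (big_fset_incl _ md) // => k _.
by rewrite memNfinsupp => /eqP ->.
Qed.

Lemma bmonom_eval_morph : monalg.mmorphism bmonom_eval.
Proof.
split=> [m1 m2|]; last by rewrite /bmonom_eval monalg.mdom1 big_nil.
rewrite !(@bmonom_evalE _ (finsupp m1 `|` finsupp m2)%fset) ?fsubsetUl
  ?fsubsetUr ?monalg.mdomD //.
by rewrite -big_split; apply: eq_bigr => k _; rewrite monalg.cmM exprD.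
Qed.

HB.instance Definition _ :=
  monalg.isMultiplicative.Build _ _ bmonom_eval bmonom_eval_morph.

(** For [f] equal to [zb_coef] this is convertible to [subst_bpoly v]; the general target also
    covers the numerical specialization [bpoly_num]. *)
Definition bpoly_eval : bpoly -> A := monalg.mmap f bmonom_eval.

HB.instance Definition _ := GRing.RMorphism.on bpoly_eval.

End EvalBpoly.

Section ZbCoef.

Lemma zb_coef_zmod : zmod_morphism zb_coef.
Proof. by move=> x y; rewrite /zb_coef -rmorphB -monalg.monalgUB. Qed.

Lemma zb_coef_monoid : monoid_morphism zb_coef.
Proof.
split=> [|x y]; first exact: rmorph1.
rewrite /zb_coef -rmorphM; congr FracField.tofrac.
exact: (rmorphM (@monalg.mkmalgU (monalg.cmonom nat) {poly int} (monalg.onecm nat))).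
Qed.

HB.instance Definition _ := GRing.isZmodMorphism.Build _ _ zb_coef zb_coef_zmod.
HB.instance Definition _ :=
  GRing.isMonoidMorphism.Build _ _ zb_coef zb_coef_monoid.

End ZbCoef.

(* Locked, as comparing two distinct monomials by conversion blows up. *)
HB.lock Definition bconst (c : {poly int}) : bpoly :=
  monalg.mkmalgU (monalg.onecm nat) c.
HB.lock Definition bvar (k : nat) : bpoly := monalg.mkmalgU (monalg.ucm k) 1.

Lemma bpoly_mulUU (m1 m2 : monalg.cmonom nat) (c1 c2 : {poly int}) :
  (monalg.mkmalgU m1 c1 : bpoly) * monalg.mkmalgU m2 c2 =
    monalg.mkmalgU (monalg.mulcm m1 m2) (c1 * c2).
Proof. by rewrite [LHS]monalg.malgM_def monalg.fgmulUU. Qed.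

Lemma bpoly_ind (P : bpoly -> Prop) :
  (forall c, P (bconst c)) -> (forall k, P (bvar k)) ->
  (forall p q, P p -> P q -> P (p + q)) ->
  (forall p q, P p -> P q -> P (p * q)) -> forall p, P p.
Proof.
rewrite bconst.unlock bvar.unlock => PC PX PD PM p.
have {PC PX} PX := conj PC PX; rewrite (monalg.monalgE p).
have P0 : P 0.
  rewrite -[0]/(0 : bpoly) -(raddf0 (@monalg.mkmalgU _ _ (monalg.onecm nat))).
  exact: PX.1.
elim: (enum_fset _) => [|m s IHs]; first by rewrite big_nil.
rewrite big_cons; apply: PD IHs; set c := monalg.mcoeff _ _.
suff PU : P (monalg.mkmalgU m 1).
  by have := PM _ _ (PX.1 c) PU; rewrite bpoly_mulUU mulr1 monalg.mul0cm.
have [n] := ubnP (monalg.mdeg m); elim: n m {c} => // n IH m.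
rewrite ltnS => degm; have [e|nz] := eqVneq (monalg.mdeg m) 0%N.
  by rewrite (monalg.mdeg_eq0I e); exact: PX.1.
have [i im] : exists i, i \in finsupp m.
  apply/fset0Pn; apply: contra_neqN nz => /eqP e.
  by rewrite monalg.mdegE e big_nil.
have e : m = monalg.mulcm (monalg.ucm i) (monalg.divcm m (monalg.ucm i)).
  apply/eqP/monalg.cmP => j; rewrite monalg.mulcmE monalg.divcmE monalg.cmU.
  have [<-|_] := eqVneq i j; last by rewrite subn0.
  by rewrite subnKC // lt0n monalg.cmE_neq0.
have : P (monalg.mkmalgU (monalg.divcm m (monalg.ucm i)) 1).
  apply: IH; apply: leq_trans degm.
  by rewrite {2}e [X in (_ < X)%N]monalg.mdegM monalg.mdegU.
by move/(PM _ _ (PX.2 i)); rewrite bpoly_mulUU mulr1 -e.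
Qed.

Lemma bpoly_evalC (A : comNzRingType) (f : {rmorphism {poly int} -> A}) v c :
  bpoly_eval f v (bconst c) = f c.
Proof. by rewrite bconst.unlock; exact: monalg.mmapC. Qed.

Lemma bpoly_evalX (A : comNzRingType) (f : {rmorphism {poly int} -> A}) v k :
  bpoly_eval f v (bvar k) = v k.+1.
Proof.
rewrite /bpoly_eval bvar.unlock [LHS]monalg.mmapU /= rmorph1 mul1r /bmonom_eval.
by rewrite monalg.mdomU big_seq_fset1 monalg.cmUU.
Qed.

Lemma frac_reprE (D : idomainType) (u : {fraction D}) :
  u = FracField.tofrac \n_(repr u) / FracField.tofrac \d_(repr u).
Proof.
set r := repr u; have dr : \d_r != 0 by exact: denom_ratioP.
apply: (canRL (mulfK _)); first by rewrite tofrac_eq0.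
rewrite -[u in LHS]reprK -/r.
unlock FracField.tofrac; rewrite -[LHS]FracField.pi_mul.
apply/eqmodP; rewrite /= FracField.equivfE /FracField.mulf.
by rewrite !numden_Ratio ?(oner_neq0, mulf_neq0) // !mulr1 mulrC.
Qed.

(** * Extension of an injective substitution to fractions *)

Section FracExtension.
Variables (R : idomainType) (phi : {rmorphism R -> {fraction R}}).
Local Notation "x %:F" := (FracField.tofrac x).

Definition frac_extend (u : {fraction R}) : {fraction R} :=
  phi \n_(repr u) / phi \d_(repr u).

(** Expresses that [phi] is an involution up to denominators. The map [sigma0] sends [b 1] to
    [- b 1 / (1 + beta * b 1)], which is not a polynomial: a power of [D] clears the denominator of
    [phi p], and applying [phi] again recovers [p] up to a power of [phi D]. In particular
    [phi p = 0] forces [p = 0]. *)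
Definition inv_upto (D p : R) := exists d q,
  phi p * D%:F ^+ d = q%:F /\ phi q = p%:F * phi D ^+ d.

Lemma inv_uptoD D p1 p2 : inv_upto D p1 -> inv_upto D p2 -> inv_upto D (p1 + p2).
Proof.
move=> [d1 [q1 [e1 f1]]] [d2 [q2 [e2 f2]]].
exists (d1 + d2)%N, (q1 * D ^+ d2 + q2 * D ^+ d1); split.
  by rewrite !(rmorphD, rmorphM, rmorphXn) /= -e1 -e2 exprD; ring.
by rewrite !(rmorphD, rmorphM, rmorphXn) /= f1 f2 exprD; ring.
Qed.

Lemma inv_uptoM D p1 p2 : inv_upto D p1 -> inv_upto D p2 -> inv_upto D (p1 * p2).
Proof.
move=> [d1 [q1 [e1 f1]]] [d2 [q2 [e2 f2]]].
exists (d1 + d2)%N, (q1 * q2); split.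
  by rewrite !rmorphM /= -e1 -e2 exprD; ring.
by rewrite !rmorphM /= f1 f2 exprD; ring.
Qed.

Lemma inv_upto_inj D : phi D != 0 -> (forall p, inv_upto D p) ->
  forall p, (phi p == 0) = (p == 0).
Proof.
move=> nD h p; apply/eqP/eqP => [p0|->]; last by rewrite rmorph0.
have [d [q [e1 e2]]] := h p.
move: e1; rewrite p0 mul0r => /esym/eqP; rewrite tofrac_eq0 => /eqP q0.
move: e2; rewrite q0 rmorph0 => /esym/eqP; rewrite mulf_eq0 tofrac_eq0.
by rewrite expf_eq0 (negPf nD) andbF orbF => /eqP.
Qed.

Hypothesis phi_eq0 : forall p, (phi p == 0) = (p == 0).

(** Independence of the chosen representative: equality of fractions is an equality of cross
    products, which [phi] preserves, and injectivity keeps the denominators nonzero. *)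
Lemma frac_extend_div p q : q != 0 -> frac_extend (p%:F / q%:F) = phi p / phi q.
Proof.
move=> nq; rewrite /frac_extend; set u := p%:F / _.
have nd : \d_(repr u) != 0 by exact: denom_ratioP.
apply/eqP; rewrite eqr_div ?phi_eq0 // -!rmorphM.
apply/eqP; congr (phi _); apply/eqP; rewrite -tofrac_eq !rmorphM /=.
by rewrite -eqr_div ?tofrac_eq0 // -frac_reprE.
Qed.

Lemma frac_extend_tofrac p : frac_extend p%:F = phi p.
Proof.
rewrite -[p%:F]divr1 -tofrac1 frac_extend_div ?oner_neq0 //.
by rewrite rmorph1 divr1.
Qed.

Lemma frac_extend_zmod : zmod_morphism frac_extend.
Proof.
move=> x y; rewrite (frac_reprE x) (frac_reprE y).
set a := \n_(repr x); set c := \d_(repr x).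
set a' := \n_(repr y); set c' := \d_(repr y).
have nc : c != 0 by exact: denom_ratioP.
have nc' : c' != 0 by exact: denom_ratioP.
rewrite -mulNr -rmorphN addf_div ?tofrac_eq0 // -!rmorphM -rmorphD.
rewrite !frac_extend_div ?mulf_neq0 //.
rewrite -mulNr addf_div ?phi_eq0 //.
by rewrite !(rmorphD, rmorphM, rmorphN).
Qed.

Lemma frac_extend_monoid : monoid_morphism frac_extend.
Proof.
split=> [|x y]; first by rewrite -tofrac1 frac_extend_tofrac rmorph1.
rewrite (frac_reprE x) (frac_reprE y).
set a := \n_(repr x); set c := \d_(repr x).
set a' := \n_(repr y); set c' := \d_(repr y).
have nc : c != 0 by exact: denom_ratioP.
have nc' : c' != 0 by exact: denom_ratioP.
rewrite mulf_div -!rmorphM !frac_extend_div ?mulf_neq0 //.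
by rewrite !rmorphM mulf_div.
Qed.

End FracExtension.

(** * Nonvanishing in the coefficient field *)

Section Substitutions.
Local Notation "x %:F" := (FracField.tofrac x).

Lemma bE k : b k = (bvar k.-1)%:F.
Proof. by rewrite bvar.unlock. Qed.

Lemma zb_coefE c : zb_coef c = (bconst c)%:F.
Proof. by rewrite bconst.unlock. Qed.

Lemma betaE : beta = (bconst 'X)%:F.
Proof. exact: zb_coefE. Qed.

Lemma subst_inj (v : nat -> coef) (D : bpoly) :
  bpoly_eval zb_coef v D != 0 ->
  (forall k, inv_upto (bpoly_eval zb_coef v) D (bvar k)) ->
  forall p, (bpoly_eval zb_coef v p == 0) = (p == 0).
Proof.
move=> nD hv; apply: (inv_upto_inj nD) => p.
elim/bpoly_ind: p => [c|k|p1 p2|p1 p2].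
- by exists 0%N, (bconst c); rewrite /= bpoly_evalC /= zb_coefE !mulr1.
- exact: hv.
- exact: inv_uptoD.
- exact: inv_uptoM.
Qed.

(** Specialization of $\beta$ to 1 and of each $b_k$ to the integer $k$. Every nonvanishing
    statement below reduces to a nonzero integer. *)
Definition bpoly_num : bpoly -> int :=
  bpoly_eval (horner_eval (1 : int)) (fun k => k%:R).

HB.instance Definition _ := GRing.RMorphism.on bpoly_num.

Lemma coef_neq0 p : bpoly_num p != 0 -> p%:F != 0 :> coef.
Proof.
by apply: contraNneq => /eqP; rewrite tofrac_eq0 => /eqP ->; rewrite rmorph0.
Qed.

Lemma bpoly_numC c : bpoly_num (bconst c) = c.[1].
Proof. by rewrite /bpoly_num bpoly_evalC. Qed.

Lemma bpoly_numX k : bpoly_num (bvar k) = k.+1%:R.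
Proof. by rewrite /bpoly_num bpoly_evalX. Qed.

Let numD : {morph bpoly_num : p q / p + q}. Proof. exact: rmorphD. Qed.
Let numM : {morph bpoly_num : p q / p * q}. Proof. exact: rmorphM. Qed.
Let num_nat n : bpoly_num n%:R = n%:R. Proof. exact: rmorph_nat. Qed.
Let nE := (numD, numM, num_nat, bpoly_numC, bpoly_numX, hornerX).

Lemma beta_neq0 : beta != 0.
Proof. by rewrite betaE coef_neq0 // bpoly_numC hornerX. Qed.

Lemma b_neq0 k : b k != 0.
Proof. by rewrite bE coef_neq0 // bpoly_numX; lia. Qed.

Lemma natD_beta_b_neq0 (m k : nat) : m.+1%:R + beta * b k != 0 :> coef.
Proof.
have -> : m.+1%:R + beta * b k = (m.+1%:R + bconst 'X * bvar k.-1)%:F.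
  by rewrite rmorphD rmorphM rmorph_nat betaE bE.
by apply: coef_neq0; rewrite !nE; lia.
Qed.

(** For [k = 0] this gives characteristic 0. For other [k] it keeps the integer points used in the
    limit argument away from the pole of [0 (-) t] and from the nonzero solution of
    [t = 0 (-) t]. *)
Lemma natD_beta_nat_neq0 (m k : nat) : m.+1%:R + beta * k%:R != 0 :> coef.
Proof.
have -> : m.+1%:R + beta * k%:R = (m.+1%:R + bconst 'X * k%:R)%:F.
  by rewrite rmorphD rmorphM !rmorph_nat betaE.
by apply: coef_neq0; rewrite !nE; lia.
Qed.

Lemma b_inj j k : (0 < j)%N -> (0 < k)%N -> (b j == b k) = (j == k).
Proof.
move=> j0 k0; apply/eqP/eqP => [/eqP|->//]; rewrite !bE tofrac_eq => /eqP.
by move/(congr1 bpoly_num); rewrite !bpoly_numX !prednK //; lia.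
Qed.

Lemma oplus_b_neq0 j k : b j (+)_beta b k != 0.
Proof.
have -> : b j (+)_beta b k =
    (bvar j.-1 + bvar k.-1 + bconst 'X * bvar j.-1 * bvar k.-1)%:F.
  by rewrite !(rmorphD, rmorphM) betaE !bE.
by apply: coef_neq0; rewrite !nE mul1r; lia.
Qed.

End Substitutions.

Lemma coef_natr_neq0 n : n.+1%:R != 0 :> coef.
Proof. by have := natD_beta_nat_neq0 n 0; rewrite mulr0 addr0. Qed.

Lemma ominus0_unit (K : fieldType) (bt x : K) : 1 + bt * x != 0 ->
  1 + bt * (0 (-)_bt x) = (1 + bt * x)^-1.
Proof. by move=> nz; rewrite /ominus; field. Qed.

Lemma ominus0_cancel (K : fieldType) (bt x : K) : 1 + bt * x != 0 ->
  (0 (-)_bt x) * (1 + bt * x) = - x /\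
  - (0 (-)_bt x) = x * (1 + bt * x)^-1.
Proof. by move=> nz; rewrite /ominus; split; field. Qed.

Section Sigma.
Local Notation "x %:F" := (FracField.tofrac x).

Let vS (i k : nat) : coef :=
  if k == i.+1 then b i.+2 else if k == i.+2 then b i.+1 else b k.

Let v0 (k : nat) : coef := if k == 1%N then 0 (-)_beta b 1 else b k.

Lemma sigmaS_inj i p : (bpoly_eval zb_coef (vS i) p == 0) = (p == 0).
Proof.
apply: (@subst_inj _ 1); first by rewrite rmorph1 oner_neq0.
move=> k; exists 0%N.
exists (bvar (if k == i then i.+1 else if k == i.+1 then i else k)).
rewrite /= !mulr1 !bpoly_evalX /vS !eqSS.
have [->|ki] := eqVneq k i; last have [->|kSi] := eqVneq k i.+1.
- by rewrite gtn_eqF // eqxx !bE.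
- by rewrite eqxx !bE.
- by rewrite (negPf ki) (negPf kSi) !bE.
Qed.

Lemma v0_unit : 1 + beta * v0 1 = (1 + beta * b 1)^-1.
Proof.
exact: ominus0_unit (natD_beta_b_neq0 0 1).
Qed.

Lemma sigma0_inj p : (bpoly_eval zb_coef v0 p == 0) = (p == 0).
Proof.
(* The denominator of the image of [b 1]; the substitution sends it to its inverse. *)
pose D := 1 + bconst 'X * bvar 0.
have DE : D%:F = 1 + beta * b 1 by rewrite rmorphD rmorphM rmorph1 betaE bE.
have phiD : bpoly_eval zb_coef v0 D = (1 + beta * b 1)^-1.
  rewrite rmorphD rmorphM rmorph1 /= bpoly_evalX bpoly_evalC /=.
  exact: v0_unit.
have nz := natD_beta_b_neq0 0 1.
apply: (@subst_inj _ D); first by rewrite phiD invr_neq0.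
case=> [|k].
  exists 1%N, (- bvar 0); rewrite !rmorphN /= !bpoly_evalX phiD DE.
  rewrite -(bE 1) /v0 eqxx.
  exact: ominus0_cancel.
by exists 0%N, (bvar k.+1); rewrite /= !mulr1 bpoly_evalX /v0 /= !bE.
Qed.

Definition sigmaS i : coef -> coef := sigma i.+1.

HB.instance Definition _ i :=
  GRing.isZmodMorphism.Build _ _ (sigmaS i) (frac_extend_zmod (sigmaS_inj i)).
HB.instance Definition _ i :=
  GRing.isMonoidMorphism.Build _ _ (sigmaS i) (frac_extend_monoid (sigmaS_inj i)).
HB.instance Definition _ :=
  GRing.isZmodMorphism.Build _ _ sigma0 (frac_extend_zmod sigma0_inj).
HB.instance Definition _ :=
  GRing.isMonoidMorphism.Build _ _ sigma0 (frac_extend_monoid sigma0_inj).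

Lemma sigmaS_beta i : sigmaS i beta = beta.
Proof.
rewrite {1}betaE [LHS](frac_extend_tofrac (sigmaS_inj i)) /=.
exact: bpoly_evalC.
Qed.

Lemma sigmaS_b i k : sigmaS i (b k.+1) =
  if k == i then b i.+2 else if k == i.+1 then b i.+1 else b k.+1.
Proof.
rewrite {1}bE [LHS](frac_extend_tofrac (sigmaS_inj i)) /=.
exact: bpoly_evalX.
Qed.

Lemma sigma0_beta : sigma0 beta = beta.
Proof.
rewrite {1}betaE [LHS](frac_extend_tofrac sigma0_inj) /=.
exact: bpoly_evalC.
Qed.

Lemma sigma0_b k : sigma0 (b k.+1) =
  if k == 0%N then 0 (-)_beta b 1 else b k.+1.
Proof.
rewrite {1}bE [LHS](frac_extend_tofrac sigma0_inj) /=.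
exact: bpoly_evalX.
Qed.

End Sigma.

(** * Symmetrizations as polynomials *)

(** Splits a permutation into the image [a] of the first index, the point picked by the first row,
    and a permutation of the other points. *)
Lemma sum_lift_perm n (V : nmodType) (f : 'S_n.+1 -> V) :
  \sum_w f w = \sum_(a < n.+1) \sum_(s : 'S_n) f (lift_perm ord0 a s).
Proof.
rewrite pair_big (reindex (fun x : 'I_n.+1 * 'S_n => lift_perm ord0 x.1 x.2)) //.
apply/onW_bij/inj_card_bij => [[a s] [a' s'] /= e|].
  have aa' : a = a' by rewrite -(lift_perm_id ord0 a s) e lift_perm_id.
  rewrite -{a'}aa' in e *; congr pair; apply/permP => k; apply: (@lift_inj _ a).
  by rewrite -!(lift_perm_lift ord0) e.
by rewrite card_prod card_ord !card_Sn factS.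
Qed.

Section PermSum.
Variables (L : fieldType) (bt : L) (g : nat -> L -> L).

Definition perm_sum n (v : 'I_n -> L) (la : seq nat) : L :=
  \sum_(w : 'S_n)
    (\prod_(j < n | (j < size la)%N) g (nth 0%N la j) (v (w j))) *
    (\prod_(i < n | (i < size la)%N) \prod_(j < n | (i < j)%N)
       xratio bt (v (w i)) (v (w j))).

Lemma rem_codom_lift n (v : 'I_n.+1 -> L) a : injective v ->
  perm_eq (rem (v a) [seq v i | i <- enum 'I_n.+1])
          [seq v (lift a i) | i <- enum 'I_n].
Proof.
move=> iv; have ue : uniq [seq v i | i <- enum 'I_n.+1].
  by rewrite map_inj_uniq // enum_uniq.
apply: uniq_perm; first exact: rem_uniq.
- by rewrite map_inj_uniq ?enum_uniq // => i j /iv/lift_inj.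
move=> x; rewrite mem_rem_uniq // inE.
apply/andP/mapP => [[/= xa /mapP[i _ e]]|[i _ ->]].
  have : a != i by apply: contraNneq xa => ->; rewrite e.
  by move=> /unlift_some[j ij _]; exists j; rewrite ?mem_enum // e ij.
rewrite (inj_eq iv) eq_sym neq_lift; split=> //.
by apply/mapP; exists (lift a i); rewrite ?mem_enum.
Qed.

(** Once the rows have picked their points, the remaining points can be permuted freely without
    changing the summand, whence the factorial. *)
Lemma perm_sumE n (v : 'I_n -> L) la : injective v -> (size la <= n)%N ->
  perm_sum v la =
    (n - size la)`!%:R * rowsum bt g (fun=> 1) la [seq v i | i <- enum 'I_n].
Proof.
elim: la n v => [|l la IH] n v iv sz /=.
  rewrite /perm_sum subn0 mulr1.
  under eq_bigr => w _ do rewrite !big_pred0_eq mulr1.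
  by rewrite sumr_const card_Sn.
case: n v iv sz => // n v iv sz.
rewrite subSS /perm_sum sum_lift_perm big_map mulr_sumr /= big_enum.
apply: eq_bigr => a _.
rewrite (perm_big _ (rem_codom_lift a iv)) /= big_map big_enum.
rewrite (perm_rowsum _ _ _ _ (rem_codom_lift a iv)) //.
have ivl : injective (v \o lift a) by move=> i j /iv/lift_inj.
rewrite [RHS]mulrCA -(IH n (v \o lift a)) // mulr_sumr.
apply: eq_bigr => s _.
set w := lift_perm ord0 a s.
have w0 : w ord0 = a by rewrite lift_perm_id.
have wS j : w (lift ord0 j) = lift a (s j) by rewrite lift_perm_lift.
rewrite big_mkcond big_ord_recl /= w0.
rewrite [X in _ * X]big_mkcond big_ord_recl /= w0.
rewrite [X in _ * (X * _)]big_mkcond big_ord_recl /= mul1r.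
have -> : \prod_(j < n) (if (bump 0 j < (size la).+1)%N
      then g (nth 0%N (l :: la) (bump 0 j)) (v (w (lift ord0 j))) else 1) =
    \prod_(j < n | (j < size la)%N) g (nth 0%N la j) (v (lift a (s j))).
  by rewrite [RHS]big_mkcond; apply: eq_bigr => j _; rewrite wS.
have -> : \prod_(j < n) xratio bt (v a) (v (w (lift ord0 j))) =
    \prod_(j < n) xratio bt (v a) (v (lift a j)).
  rewrite [RHS](reindex_inj (@perm_inj _ s)).
  by apply: eq_bigr => j _; rewrite wS.
set p1 := \prod_(i < n | _) g _ _; set p2 := \prod_(i < n) xratio _ _ _.
rewrite -[RHS]mulrA; set p3 := (X in p2 * X); rewrite -!mulrA.
congr (_ * _); rewrite mulrCA; congr (_ * (_ * _)).
rewrite /p3 [RHS]big_mkcond; apply: eq_bigr => i _.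
rewrite wS -[(bump 0 i < _)%N]/(i < size la)%N.
case: ifP => // _; rewrite big_mkcond big_ord_recl /= mul1r.
by rewrite [RHS]big_mkcond; apply: eq_bigr => j _; rewrite wS.
Qed.

End PermSum.

Lemma mpoly_ring_ind n (R : comNzRingType) (P : {mpoly R[n]} -> Prop) :
  (forall c, P c%:MP) -> (forall i, P 'X_i) ->
  (forall p q, P p -> P q -> P (p + q)) ->
  (forall p q, P p -> P q -> P (p * q)) -> forall p, P p.
Proof.
move=> PC PX PD PM p; rewrite (mpolyE p).
apply: (big_ind P) => [||m _]; [by rewrite -mpolyC0 | exact: PD |].
rewrite -mul_mpolyC; apply: (PM) => //; rewrite mpolyXE_id.
apply: (big_ind P) => [||i _]; [by rewrite -mpolyC1 | exact: PM |].
elim: (m i) => [|k IH]; first by rewrite expr0 -mpolyC1.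
by rewrite exprS; apply: PM.
Qed.

(** * Divisibility by the Vandermonde product *)

Section VandermondeDivision.
Variables (n : nat) (F : fieldType).
Implicit Types (p q : {mpoly F[n]}).

(** Restriction to the hyperplane where the two variables of [e] agree, kept in the same polynomial
    ring. *)
Definition collapse (e : 'I_n * 'I_n) : {mpoly F[n]} -> {mpoly F[n]} :=
  mmap (@mpolyC n F) (fun k => if k == e.2 then 'X_e.1 else 'X_k).

HB.instance Definition _ e := GRing.RMorphism.on (collapse e).

Lemma collapseC e c : collapse e c%:MP = c%:MP.
Proof. exact: mmapC. Qed.

Lemma collapseX e k : collapse e 'X_k = if k == e.2 then 'X_e.1 else 'X_k.
Proof. by rewrite /collapse mmapX mmap1U. Qed.

Lemma collapse_divides e p : exists q, p - collapse e p = q * ('X_e.2 - 'X_e.1).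
Proof.
elim/mpoly_ring_ind: p => [c|k|p1 p2 [q1 e1] [q2 e2]|p1 p2 [q1 e1] [q2 e2]].
- by exists 0; rewrite collapseC subrr mul0r.
- rewrite collapseX; case: eqP => [->|_]; first by exists 1; rewrite mul1r.
  by exists 0; rewrite subrr mul0r.
- by exists (q1 + q2); rewrite rmorphD mulrDl -e1 -e2; ring.
- exists (q1 * p2 + collapse e p1 * q2).
  rewrite rmorphM.
  transitivity ((p1 - collapse e p1) * p2 +
                collapse e p1 * (p2 - collapse e p2)); first by ring.
  by rewrite e1 e2; ring.
Qed.

Lemma mpolyX_inj : injective (fun i : 'I_n => 'X_i : {mpoly F[n]}).
Proof.
move=> i j /(congr1 (mcoeff U_(i))); rewrite !mcoeffX eqxx.
case: eqP => [e _|_ /eqP]; last by rewrite oner_eq0.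
have := congr1 (fun m : 'X_{1..n} => m i) e; rewrite !mnmE eqxx.
by case: eqP => // ->.
Qed.

(** Replaces coprimality of the linear factors: one that has been divided out does not vanish on the
    other hyperplanes, so the quotient still does. *)
Lemma collapse_diff_neq0 (e e' : 'I_n * 'I_n) :
  (e.1 < e.2)%N -> (e'.1 < e'.2)%N -> e != e' ->
  collapse e' ('X_e.2 - 'X_e.1) != 0.
Proof.
case: e e' => [i j] [i' j'] /= ij ij' ne; rewrite rmorphB /= !collapseX /=.
rewrite subr_eq0; have Xi := inj_eq mpolyX_inj.
have [e1|n1] := eqVneq j j'; have [e2|n2] := eqVneq i j'; rewrite Xi -?val_eqE /=.
- by move: ij; rewrite e1 e2 ltnn.
- by apply: contra ne => /eqP/val_inj <-; rewrite e1.
- by move: ij ij'; rewrite e2; lia.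
- by rewrite eq_sym neq_ltn ij.
Qed.

Lemma collapse_all_divides (es : seq ('I_n * 'I_n)) p :
  uniq es -> (forall e, e \in es -> (e.1 < e.2)%N) ->
  (forall e, e \in es -> collapse e p = 0) ->
  exists q, p = q * \prod_(e <- es) ('X_e.2 - 'X_e.1).
Proof.
elim: es p => [|e es IH] p; first by exists p; rewrite big_nil mulr1.
move=> /andP[ee ues] lt pe.
have [q] := collapse_divides e p; rewrite pe ?mem_head // subr0 => pq.
have [|e' e'es|q' qq] := IH q ues.
- by move=> e' e'es; apply: lt; rewrite inE e'es orbT.
- have := pe e'; rewrite inE e'es orbT => /(_ isT).
  rewrite pq rmorphM => /eqP; rewrite mulf_eq0 => /orP[/eqP //|].
  rewrite (negPf (collapse_diff_neq0 _ _ _)) //.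
  + exact/lt/mem_head.
  + by apply: lt; rewrite inE e'es orbT.
  + by apply: contraNneq ee => ->.
by exists q'; rewrite pq qq big_cons; ring.
Qed.

End VandermondeDivision.

(** * Symmetrizations as quotients of antisymmetric polynomials *)

Section Numerator.
Variables (F : fieldType) (bt : F) (G : nat -> {poly F}) (la : seq nat) (n : nat).

Definition row_fun (L : nzRingType) (phi : F -> L) (l : nat) (x : L) : L :=
  (map_poly phi (G l)).[x].

(** One term of the symmetrization times the Vandermonde product. The minus sign arises because the
    ratio has denominator [v i - v j] while the Vandermonde factor is [v j - v i]. *)
Definition numer (L : comNzRingType) (phi : F -> L) (v : 'I_n -> L) : L :=
  (\prod_(j < n | (j < size la)%N) row_fun phi (nth 0%N la j) (v j)) *
  (\prod_(i < n) \prod_(j < n | (i < j)%N)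
     if (i < size la)%N then
       - ((v i + v j + phi bt * v i * v j) * (1 + phi bt * v j))
     else v j - v i).

Definition vander (L : comNzRingType) (v : 'I_n -> L) : L :=
  \prod_(i < n) \prod_(j < n | (i < j)%N) (v j - v i).

Lemma vander_perm (L : comNzRingType) (v : 'I_n -> L) (w : 'S_n) :
  vander (v \o w) = (-1) ^+ w * vander v.
Proof.
have E (u : 'I_n -> L) : vander u = \det (Vandermonde n (\row_i u i)).
  rewrite det_Vandermonde; apply: eq_bigr => i _; apply: eq_bigr => j _.
  by rewrite !mxE.
have -> : vander (v \o w) = \det (col_perm w (Vandermonde n (\row_i v i))).
  by rewrite E; congr (\det _); apply/matrixP => i j; rewrite !mxE.
by rewrite col_permE det_mulmx det_perm odd_permV mulrC E.
Qed.

Lemma vander_neq0 (L : fieldType) (v : 'I_n -> L) : injective v -> vander v != 0.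
Proof.
move=> iv; apply/prodf_neq0 => i _; apply/prodf_neq0 => j ij.
by rewrite subr_eq0 (inj_eq iv) -val_eqE /= eq_sym neq_ltn ij.
Qed.

Lemma numer_morph (A L : comNzRingType) (phi : {rmorphism F -> A})
    (psi : {rmorphism A -> L}) (v : 'I_n -> A) :
  psi (numer phi v) = numer (psi \o phi) (psi \o v).
Proof.
rewrite rmorphM !rmorph_prod /=; congr (_ * _).
  apply: eq_bigr => j _; rewrite /row_fun /= map_poly_comp.
  by rewrite horner_map.
apply: eq_bigr => i _; rewrite rmorph_prod; apply: eq_bigr => j _ /=.
by case: ifP => _; rewrite ?rmorphB // rmorphN !(rmorphM, rmorphD) rmorph1.
Qed.

Lemma numer_term (L : fieldType) (phi : {rmorphism F -> L}) (v : 'I_n -> L) :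
  injective v ->
  numer phi v = vander v *
    ((\prod_(j < n | (j < size la)%N) row_fun phi (nth 0%N la j) (v j)) *
    (\prod_(i < n | (i < size la)%N) \prod_(j < n | (i < j)%N)
       xratio (phi bt) (v i) (v j))).
Proof.
move=> iv; rewrite /numer [RHS]mulrCA; congr (_ * _).
rewrite [X in _ * X]big_mkcond -big_split; apply: eq_bigr => i _ /=.
case: ifP => _; last by rewrite mulr1.
rewrite -big_split; apply: eq_bigr => j ij /=; rewrite xratioE /oplus.
have : v i - v j != 0 by rewrite subr_eq0 (inj_eq iv) -val_eqE /= neq_ltn ij.
by move=> nz; field.
Qed.

Hypothesis char0 : forall k, k.+1%:R != 0 :> F.

Let antinumer : {mpoly F[n]} :=
  \sum_(w : 'S_n) (-1) ^+ w * numer (@mpolyC n F) (fun i => 'X_(w i)).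

Let mmap_antinumer (L : comNzRingType) (phi : {rmorphism F -> L}) (v : 'I_n -> L) :
  mmap phi v antinumer = \sum_(w : 'S_n) (-1) ^+ w * numer phi (v \o w).
Proof.
rewrite rmorph_sum; apply: eq_bigr => w _.
rewrite rmorphM rmorphXn rmorphN rmorph1 numer_morph /=; congr (_ * _).
rewrite /numer; congr (_ * _); apply: eq_bigr => i _ /=.
  rewrite /row_fun mmapX mmap1U; congr horner; apply: eq_map_poly => c.
  exact: mmapC.
by apply: eq_bigr => j _; rewrite mmapC !mmapX !mmap1U.
Qed.

Let collapse_antinumer e : e.1 != e.2 -> collapse e antinumer = 0.
Proof.
case: e => i j /= ij; rewrite /collapse mmap_antinumer.
pose u k : {mpoly F[n]} := if k == j then 'X_i else 'X_k; rewrite -/u.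
set S := LHS; have uK k : u (tperm i j k) = u k.
  rewrite /u; case: tpermP => [->|->|//]; first by rewrite eqxx (negPf ij).
  by rewrite eqxx (negPf ij).
have : S = - S.
  (* Composing with the transposition leaves the points unchanged, as [u i = u j], and reverses the
     sign. *)
  rewrite {1}/S (reindex_inj (mulIg (tperm i j))) -sumrN; apply: eq_bigr => w _.
  rewrite odd_permM odd_tperm ij addbT -mulNr; congr (_ * _).
    by case: (odd_perm w); rewrite /= ?expr0 ?expr1 ?opprK.
  rewrite /numer; congr (_ * _); apply: eq_bigr => k _ /=.
    by rewrite permM uK.
  by apply: eq_bigr => k' _; rewrite !permM !uK.
move/eqP; rewrite -subr_eq0 opprK -mulr2n -scaler_nat scaler_eq0.
by rewrite (negPf (char0 1)) => /eqP.
Qed.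

(** The quotient by the Vandermonde product is formed over [F], before any evaluation, so that the
    same [P] serves every field [L] and every embedding. *)
Lemma exists_perm_sum_poly : exists P : {mpoly F[n]},
  forall (L : fieldType) (phi : {rmorphism F -> L}) (v : 'I_n -> L),
    injective v ->
    mmap phi v P = perm_sum (phi bt) (row_fun phi) v la.
Proof.
pose es := enum [pred e : 'I_n * 'I_n | (e.1 < e.2)%N].
have [||P antiE] := @collapse_all_divides n F es antinumer (enum_uniq _).
- by move=> e; rewrite mem_enum.
- move=> e; rewrite mem_enum inE => lt_e; apply: collapse_antinumer.
  by rewrite -val_eqE neq_ltn lt_e.
have esE : \prod_(e <- es) ('X_e.2 - 'X_e.1) =
    vander (fun i => 'X_i : {mpoly F[n]}).
  by rewrite /es big_enum /= /vander pair_big_dep.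
exists P => L phi v iv; apply: (mulfI (vander_neq0 iv)).
have vE : mmap phi v (vander (fun i => 'X_i)) = vander v.
  rewrite rmorph_prod; apply: eq_bigr => i _; rewrite rmorph_prod.
  by apply: eq_bigr => j _; rewrite rmorphB /= !mmapX !mmap1U.
have := congr1 (mmap phi v) antiE.
rewrite mmap_antinumer rmorphM /= esE vE mulrC => <-.
rewrite mulr_sumr; apply: eq_bigr => w _.
rewrite numer_term; last exact: inj_comp iv perm_inj.
(* The sign of the permuted Vandermonde product cancels the sign of the antisymmetrization, so the
   quotient is a plain sum. *)
by rewrite vander_perm !mulrA -signr_addb addbb mul1r.
Qed.

Lemma exists_rowsum_poly : (size la <= n)%N -> exists P : {mpoly F[n]},
  forall (L : fieldType) (phi : {rmorphism F -> L}) (v : 'I_n -> L),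
    injective v ->
    mmap phi v P =
      rowsum (phi bt) (row_fun phi) (fun=> 1) la [seq v i | i <- enum 'I_n].
Proof.
move=> sz; have [P PE] := exists_perm_sum_poly.
have nz : (n - size la)`!%:R != 0 :> F.
  by rewrite -(prednK (fact_gt0 _)).
exists (((n - size la)`!%:R)^-1 *: P) => L phi v iv.
rewrite mmapZ PE // perm_sumE // fmorphV rmorph_nat mulKf //.
by rewrite -(rmorph_nat phi) fmorph_eq0.
Qed.

End Numerator.

(** * Levels and stability *)

Section Evaluation.

Lemma mmap_comp n (R : comNzRingType) (A L : comNzRingType)
    (phi : {rmorphism R -> A}) (psi : {rmorphism A -> L}) (v : 'I_n -> A) p :
  psi (mmap phi v p) = mmap (psi \o phi) (psi \o v) p.
Proof.
elim/mpoly_ring_ind: p => [c|i|p q ep eq|p q ep eq].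
- by rewrite !mmapC.
- by rewrite !mmapX !mmap1U.
- by rewrite !rmorphD ep eq.
- by rewrite !rmorphM ep eq.
Qed.

Lemma eq_mmap n (R : nzRingType) (L : comNzRingType) (f f' : R -> L)
    (v v' : 'I_n -> L) (p : {mpoly R[n]}) :
  f =1 f' -> v =1 v' -> mmap f v p = mmap f' v' p.
Proof.
by move=> ef ev; apply: eq_bigr => m _; rewrite ef (mmap1_eq _ ev).
Qed.

(** Entries beyond the end of [xs] are read as 0, so evaluation at a shorter list includes setting
    the last variables to 0. *)
Definition ev n (R L : comNzRingType) (phi : R -> L) (xs : seq L)
    (p : {mpoly R[n]}) : L :=
  mmap phi (fun i : 'I_n => nth 0 xs i) p.

Definition mvars n (R : comNzRingType) : seq {mpoly R[n]} :=
  [seq 'X_i | i <- enum 'I_n].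

Lemma size_mvars n (R : comNzRingType) : size (mvars n R) = n.
Proof. by rewrite size_map size_enum_ord. Qed.

Lemma nth_mvars n (R : comNzRingType) (i : 'I_n) : nth 0 (mvars n R) i = 'X_i.
Proof.
by rewrite (nth_map i) ?size_enum_ord // nth_ord_enum.
Qed.

Lemma ev_mvars n (R : comNzRingType) (p : {mpoly R[n]}) :
  ev (@mpolyC n R) (mvars n R) p = p.
Proof.
rewrite -[RHS]comp_mpoly_id; apply: eq_mmap => // i.
by rewrite nth_mvars tnth_mktuple.
Qed.

Lemma ev_trunc n m (R L : comNzRingType) (phi : {rmorphism R -> L}) xs
    (p : {mpoly R[m]}) :
  (size xs <= n)%N -> ev phi xs (ev (@mpolyC n R) (mvars n R) p) = ev phi xs p.
Proof.
move=> sz; rewrite {1}/ev mmap_comp; apply: eq_mmap => [c|i] /=.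
  by rewrite mmapC.
have [lt|ge] := ltnP i n.
  by rewrite (nth_mvars _ (Ordinal lt)) mmapX mmap1U.
by rewrite !nth_default ?rmorph0 ?size_mvars // (leq_trans sz).
Qed.

Lemma ev_rmorph n (R A L : comNzRingType) (phi : {rmorphism R -> A})
    (psi : {rmorphism A -> L}) xs (p : {mpoly R[n]}) :
  psi (ev phi xs p) = ev (psi \o phi) (map psi xs) p.
Proof.
rewrite /ev mmap_comp; apply: eq_mmap => // i /=.
have [lt|ge] := ltnP i (size xs); first by rewrite (nth_map 0).
by rewrite !nth_default ?size_map // rmorph0.
Qed.

Lemma nth_rcons0 (V : zmodType) (xs : seq V) k i :
  nth 0 (xs ++ nseq k 0) i = nth 0 xs i.
Proof.
rewrite nth_cat; case: ltnP => // h; rewrite nth_nseq if_same.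
by rewrite nth_default.
Qed.

Lemma ev_cat0 n (R L : comNzRingType) (phi : R -> L) xs k (p : {mpoly R[n]}) :
  ev phi (xs ++ nseq k 0) p = ev phi xs p.
Proof. by apply: eq_mmap => // i; rewrite nth_rcons0. Qed.

End Evaluation.

Section Rows.

Definition rowP (K : fieldType) (bt : K) (c : nat -> K) l x : K :=
  \prod_(1 <= k < l.+1) (x (+)_bt c k).

Definition rowQ (K : fieldType) (bt : K) (c : nat -> K) l x : K :=
  (x (+)_bt x) * \prod_(1 <= k < l) (x (+)_bt c k).

Definition rowX (X : ctype) (K : fieldType) (bt : K) (c : nat -> K) :
    nat -> K -> K :=
  match X with
  | tB => rowP bt (fun k => if k == 1%N then 0 else c k.-1)
  | tC => rowQ bt c
  | tD => rowP bt c
  end.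

Variables (F : fieldType) (bt : F).

Definition oplus_poly (c : F) : {poly F} := 'X + c%:P + bt%:P * 'X * c%:P.

Lemma oplus_polyE (L : fieldType) (phi : {rmorphism F -> L}) c x :
  (map_poly phi (oplus_poly c)).[x] = x (+)_(phi bt) phi c.
Proof.
by rewrite !(rmorphD, rmorphM) /= !map_polyC map_polyX !hornerE.
Qed.

Definition rowpoly (X : ctype) (c : nat -> F) (l : nat) : {poly F} :=
  match X with
  | tB => \prod_(1 <= k < l.+1) oplus_poly (if k == 1%N then 0 else c k.-1)
  | tC => ('X + 'X + bt%:P * 'X * 'X) * \prod_(1 <= k < l) oplus_poly (c k)
  | tD => \prod_(1 <= k < l.+1) oplus_poly (c k)
  end.

Lemma row_fun_rowpoly X c (L : fieldType) (phi : {rmorphism F -> L}) l x :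
  row_fun (rowpoly X c) phi l x = rowX X (phi bt) (phi \o c) l x.
Proof.
rewrite /row_fun; case: X => /=.
- rewrite rmorph_prod horner_prod /rowP; apply: eq_bigr => k _.
  by rewrite oplus_polyE; case: eqP => //= _; rewrite rmorph0.
- rewrite rmorphM hornerM rmorph_prod horner_prod /rowQ; congr (_ * _).
    by rewrite !(rmorphD, rmorphM) /= map_polyC map_polyX !hornerE.
  by apply: eq_bigr => k _; rewrite oplus_polyE.
- rewrite rmorph_prod horner_prod /rowP; apply: eq_bigr => k _.
  by rewrite oplus_polyE.
Qed.

End Rows.

Definition GXsum X (K : fieldType) (bt : K) (c : nat -> K) (la : seq nat)
    (xs : seq K) : K :=
  rowsum bt (rowX X bt c) (fun=> 1) la xs.

(** * The limit of two opposite points tending to 0 *)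

Section OppositeLimit.
Variables (F : comNzRingType) (K : fieldType) (phi : {rmorphism F -> K}) (bt : K).
Variables (n : nat) (xs : seq K).
Implicit Types p : {mpoly F[n]}.

Let at_opp (t : K) : seq K := xs ++ [:: t; 0 (-)_bt t].

(** Since [0 (-) t] is [- t / (1 + bt * t)], the evaluation is rational in [t] with a power of
    [1 + bt * t] as denominator. *)
Let ev_opp_rational p : exists d (U : {poly K}), forall t, 1 + bt * t != 0 ->
  ev phi (at_opp t) p * (1 + bt * t) ^+ d = U.[t].
Proof.
elim/mpoly_ring_ind: p => [c|i|p q [d [U e]] [d' [U' e']]|p q [d [U e]] [d' [U' e']]].
- by exists 0%N, (phi c)%:P => t _; rewrite /ev mmapC hornerC mulr1.
- rewrite /ev /at_opp.
  suff [d [U e]] : exists d (U : {poly K}), forall t, 1 + bt * t != 0 ->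
      nth 0 (xs ++ [:: t; 0 (-)_bt t]) i * (1 + bt * t) ^+ d = U.[t].
    by exists d, U => t /e <-; rewrite mmapX mmap1U.
  have [lt|ge] := ltnP i (size xs).
    exists 0%N, (nth 0 xs i)%:P => t _.
    by rewrite nth_cat lt mulr1 hornerC.
  case ei : (i - size xs)%N => [|[|k]].
  + by exists 0%N, 'X => t _; rewrite nth_cat ltnNge ge /= ei mulr1 hornerX.
  + exists 1%N, (- 'X) => t nz; rewrite nth_cat ltnNge ge /= ei /= hornerN hornerX.
    by rewrite /ominus expr1 divfK // sub0r.
  + by exists 0%N, 0 => t _; rewrite nth_cat ltnNge ge /= ei /= nth_nil mul0r horner0.
- exists (d + d')%N, (U * ((1 + bt *: 'X) ^+ d') + U' * (1 + bt *: 'X) ^+ d) => t nz.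
  rewrite !hornerE -e // -e' // /ev rmorphD exprD /=.
  by ring.
- exists (d + d')%N, (U * U') => t nz.
  by rewrite hornerM -e // -e' // /ev rmorphM exprD /=; ring.
Qed.

Hypothesis natD_neq0 : forall m k, m.+1%:R + bt * k%:R != 0.

(** An algebraic substitute for the limit: a polynomial relation in [t] that holds at all positive
    integers is an identity, and can be read at [t = 0]. *)
Lemma ev_opp_limit p (c : K) :
  (forall k, ev phi (at_opp k.+1%:R) p = c) -> ev phi xs p = c.
Proof.
move=> ec; have [d [U e]] := ev_opp_rational p.
pose W := U - c%:P * (1 + bt *: 'X) ^+ d.
pose rs := [seq k.+1%:R : K | k <- iota 0 (size W)].
have W0 : W = 0.
  apply: (@roots_geq_poly_eq0 _ _ rs).
  - apply/allP => x /mapP[k _ ->]; rewrite /root !hornerE subr_eq0 -e.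
      by rewrite ec.
    exact: (natD_neq0 0).
  - rewrite map_inj_in_uniq ?iota_uniq // => i j _ _.
    have char0 k : k.+1%:R != 0 :> K by have := natD_neq0 k 0; rewrite mulr0 addr0.
    wlog ij : i j / (i <= j)%N => [W1 h|].
      by case/orP: (leq_total i j) => /W1; [exact | move=> /(_ (esym h)) ->].
    rewrite -(subnKC ij) -addSn natrD => /eqP; rewrite -subr_eq0 opprD addNKr.
    by rewrite oppr_eq0; case: (j - i)%N => [|k]; rewrite ?addn0 // (negPf (char0 k)).
  - by rewrite size_map size_iota.
have nz0 : 1 + bt * 0 != 0 by rewrite mulr0 addr0 oner_neq0.
have := e 0 nz0; rewrite mulr0 addr0 expr1n mulr1.
(* At [t = 0] both added points are 0, which [ev] does not see. *)
have -> : at_opp 0 = xs ++ nseq 2 0 by rewrite /at_opp /ominus subrr mul0r.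
rewrite ev_cat0 => ->; have := congr1 (horner^~ 0) W0.
rewrite /W !hornerE ?mulr0 ?addr0 ?expr1n ?mulr1 => /eqP.
by rewrite subr_eq0 => /eqP.
Qed.

End OppositeLimit.

Section FieldOfVariables.
Variable F : fieldType.

Definition fconst n : {rmorphism F -> {fraction {mpoly F[n]}}} :=
  @FracField.tofrac {mpoly F[n]} \o @mpolyC n F.

Definition fvars n : seq {fraction {mpoly F[n]}} :=
  map (@FracField.tofrac _) (mvars n F).

Lemma size_fvars n : size (fvars n) = n.
Proof. by rewrite size_map size_mvars. Qed.

Lemma fvars_uniq n : uniq (fvars n).
Proof.
rewrite map_inj_uniq => [|p q /eqP]; last by rewrite tofrac_eq => /eqP.
by rewrite map_inj_uniq ?enum_uniq //; exact: mpolyX_inj.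
Qed.

Lemma fconst_notin_fvars n a : fconst n a \notin fvars n.
Proof.
apply/mapP => -[p /mapP[i _ ->] /eqP]; rewrite /= tofrac_eq => /eqP.
move/(congr1 (mcoeff U_(i))); rewrite mcoeffC mcoeffX eqxx.
have /negPf-> : (U_(i) != 0)%MM.
  by apply/eqP => /(congr1 (fun m : 'X_{1..n} => m i)); rewrite mnm0E mnmE eqxx.
by rewrite mulr0 => /eqP; rewrite eq_sym oner_eq0.
Qed.

Lemma tofrac_ev n m (p : {mpoly F[m]}) :
  FracField.tofrac (ev (@mpolyC n F) (mvars n F) p) = ev (fconst n) (fvars n) p.
Proof. by rewrite ev_rmorph. Qed.

Lemma tofrac_fvars n (p : {mpoly F[n]}) :
  FracField.tofrac p = ev (fconst n) (fvars n) p.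
Proof. by rewrite -tofrac_ev ev_mvars. Qed.

Lemma tofrac_inj n : injective (@FracField.tofrac {mpoly F[n]}).
Proof. by move=> p q /eqP; rewrite tofrac_eq => /eqP. Qed.

End FieldOfVariables.

Section Levels.
Variables (F : fieldType) (bt : F) (c : nat -> F) (X : ctype) (la : seq nat).
Hypothesis natD_neq0 : forall m k, m.+1%:R + bt * k%:R != 0.
Hypothesis la_pos : 0%N \notin la.

Definition is_level n (P : {mpoly F[n]}) : Prop :=
  forall (L : fieldType) (phi : {rmorphism F -> L}) (xs : seq L),
    uniq xs -> size xs = n ->
    ev phi xs P = GXsum X (phi bt) (phi \o c) la xs.

Definition level n : {mpoly F[n]} :=
  epsilon (inhabits (0 : {mpoly F[n]})) (@is_level n).

Let char0 k : k.+1%:R != 0 :> F.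
Proof. by have := natD_neq0 k 0; rewrite mulr0 addr0. Qed.

Lemma levelP n : (size la <= n)%N -> is_level (level n).
Proof.
move=> sz; apply: (epsilon_spec (inhabits _) (@is_level n)).
have [P PE] := exists_rowsum_poly bt (rowpoly bt X c) char0 sz.
exists P => L phi xs uxs sxs; rewrite /ev PE => [|i j /eqP]; last first.
  by rewrite nth_uniq ?sxs // => /eqP/val_inj.
have -> : [seq nth 0 xs i | i : 'I_n <- enum 'I_n] = xs.
  rewrite -[RHS](mkseq_nth 0) /mkseq sxs -val_enum_ord -map_comp.
  exact: eq_map.
by apply: eq_rowsum_fun => l x _; exact: row_fun_rowpoly.
Qed.


Lemma oplus0 (K : fieldType) (b' x : K) : x (+)_b' 0 = x.
Proof. by rewrite /oplus mulr0 !addr0. Qed.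

Lemma rowX_at0 (K : fieldType) (b' : K) (c' : nat -> K) l :
  X <> tD -> (0 < l)%N -> rowX X b' c' l 0 = 0.
Proof.
case: X => // _ l0 /=; last by rewrite /rowQ oplus0 mul0r.
by rewrite /rowP big_ltn //= oplus0 mul0r.
Qed.

Let natD_fconst n m k : m.+1%:R + fconst F n bt * k%:R != 0.
Proof.
have -> : m.+1%:R + fconst F n bt * k%:R = fconst F n (m.+1%:R + bt * k%:R).
  by rewrite rmorphD rmorphM !rmorph_nat.
by rewrite fmorph_eq0.
Qed.

(** In types B and C every row factor vanishes at 0, and [xratio x 0] is 1, so a point 0 can be
    added freely. In type D the row factors do not vanish at 0, which is why [level_step2] adds two
    points. *)
Lemma level_step1 n : X <> tD -> (size la <= n)%N ->
  ev (@mpolyC n F) (mvars n F) (level n.+1) = level n.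
Proof.
move=> nD sz; apply: tofrac_inj; rewrite tofrac_ev tofrac_fvars.
have ux : uniq (0 :: fvars F n).
  by rewrite /= fvars_uniq andbT -(rmorph0 (fconst F n)) fconst_notin_fvars.
have pe : perm_eq (fvars F n ++ [:: 0]) (0 :: fvars F n).
  by rewrite perm_catC.
rewrite -(ev_cat0 _ _ 1) [LHS]levelP ?(leqW sz) ?(perm_uniq pe) //; last first.
  by rewrite size_cat size_fvars addn1.
rewrite [RHS]levelP ?fvars_uniq ?size_fvars // /GXsum.
rewrite (perm_rowsum _ _ _ _ pe) //.
apply: rowsum_add_point => // [||  |l lla|l x lla xin].
- by case/andP: ux.
- by case/andP: ux.
- by rewrite size_fvars.
- by apply: rowX_at0; rewrite // lt0n; apply: contraNneq la_pos => <-.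
rewrite xratioE oplus0 mulr0 addr0 mulr1 subr0 divff ?mulr1 //.
by case/andP: ux => + _; apply: contraNneq => <-.
Qed.

Lemma xratio_opp (K : fieldType) (b' t : K) : 1 + b' * t != 0 ->
  xratio b' t (0 (-)_b' t) = 0 /\ xratio b' (0 (-)_b' t) t = 0.
Proof.
move=> nz; have e : t (+)_b' (0 (-)_b' t) = 0 by rewrite /oplus /ominus; field.
rewrite /xratio e mul0r; split=> //.
suff -> : (0 (-)_b' t) (+)_b' t = 0 by rewrite mul0r.
by rewrite -[RHS]e /oplus; ring.
Qed.

Lemma xratio_mul_opp (K : fieldType) (b' t x : K) :
  1 + b' * t != 0 -> x != t -> x != 0 (-)_b' t ->
  xratio b' x t * xratio b' x (0 (-)_b' t) = 1.
Proof.
move=> nz xt xt'; rewrite !xratioE.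
have e : x - (0 (-)_b' t) = (x (+)_b' t) / (1 + b' * t).
  by rewrite /oplus /ominus; field.
have n1 : x - t != 0 by rewrite subr_eq0.
have n2 : x (+)_b' t != 0.
  by move: xt'; rewrite -subr_eq0 e mulf_eq0 invr_eq0 (negPf nz) orbF.
rewrite e; move: n2; rewrite /oplus /ominus => n2; field.
by rewrite n1 n2 nz.
Qed.

Lemma neq_opp (K : fieldType) (b' t : K) :
  t != 0 -> 1 + b' * t != 0 -> 2 + b' * t != 0 -> t != 0 (-)_b' t.
Proof.
move=> n0 n1 n2; rewrite -subr_eq0 /ominus.
have -> : t - (0 - t) / (1 + b' * t) = t * (2 + b' * t) / (1 + b' * t) by field.
by rewrite !mulf_neq0 ?invr_eq0.
Qed.

Lemma perm_GXsum (K : fieldType) (b' : K) (c' : nat -> K) la' xs xs' :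
  perm_eq xs xs' -> GXsum X b' c' la' xs = GXsum X b' c' la' xs'.
Proof. exact: perm_rowsum. Qed.

Lemma GXsum_add_opposite (K : fieldType) (b' : K) (c' : nat -> K) t xs :
  1 + b' * t != 0 -> t != 0 (-)_b' t -> t \notin xs -> 0 (-)_b' t \notin xs ->
  GXsum X b' c' la [:: t, 0 (-)_b' t & xs] = GXsum X b' c' la xs.
Proof.
move=> nz tt' tx tx'; have [r1 r2] := xratio_opp nz.
apply: rowsum_add_opposite => // x xin; apply: xratio_mul_opp => //.
  by apply: contraNneq tx => <-.
by apply: contraNneq tx' => <-.
Qed.

Lemma level_step2 n : (size la <= n)%N ->
  ev (@mpolyC n F) (mvars n F) (level n.+2) = level n.
Proof.
move=> sz; apply: tofrac_inj; rewrite tofrac_ev tofrac_fvars.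
apply: (ev_opp_limit (natD_fconst n)) => k.
set b' := fconst F n bt; set t : {fraction _} := k.+1%:R.
have nz : 1 + b' * t != 0 by exact: (natD_fconst n 0 k.+1).
have tE : t = fconst F n k.+1%:R by rewrite rmorph_nat.
have t'E : 0 (-)_b' t = fconst F n (0 (-)_bt k.+1%:R).
  by rewrite /ominus rmorphM rmorphB rmorph0 fmorphV rmorphD rmorphM rmorph1 -tE.
have nt : t != 0 by rewrite tE fmorph_eq0.
have tt' : t != 0 (-)_b' t := neq_opp nt nz (natD_fconst n 1 k.+1).
clearbody t.
have tx : t \notin fvars F n by rewrite tE fconst_notin_fvars.
have tx' : 0 (-)_b' t \notin fvars F n by rewrite t'E fconst_notin_fvars.
have pe : perm_eq (fvars F n ++ [:: t; 0 (-)_b' t]) [:: t, 0 (-)_b' t & fvars F n].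
  by rewrite perm_catC.
rewrite [LHS]levelP ?(leqW (leqW sz)) ?(perm_uniq pe) //; first last.
- by rewrite size_cat size_fvars addn2.
- by rewrite /= inE negb_or tt' tx tx' fvars_uniq.
rewrite [RHS]levelP ?fvars_uniq ?size_fvars // (perm_GXsum _ _ _ pe).
exact: (GXsum_add_opposite _ nz tt' tx tx').
Qed.

Lemma ev_level_step1 (L : comNzRingType) (phi : {rmorphism F -> L}) xs n :
  X <> tD -> (size la <= n)%N -> (size xs <= n)%N ->
  ev phi xs (level n.+1) = ev phi xs (level n).
Proof. by move=> nD sz szx; rewrite -[in RHS]level_step1 // ev_trunc. Qed.

Lemma ev_level_step2 (L : comNzRingType) (phi : {rmorphism F -> L}) xs n :
  (size la <= n)%N -> (size xs <= n)%N ->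
  ev phi xs (level n.+2) = ev phi xs (level n).
Proof. by move=> sz szx; rewrite -[in RHS]level_step2 // ev_trunc. Qed.

Lemma ev_level_stable (L : comNzRingType) (phi : {rmorphism F -> L}) xs n m :
  (size la <= n)%N -> (size xs <= n)%N -> (n <= m)%N ->
  (X = tD -> odd n = odd m) -> ev phi xs (level m) = ev phi xs (level n).
Proof.
move=> sz szx /subnKC <-; move: (m - n)%N => d par.
have [D|nD] : X = tD \/ X <> tD by case: (X); [right|right|left].
  have {par} : ~~ odd d by move/(_ D): par; rewrite oddD; case: odd; case: odd.
  have [h] := ubnP d; elim: h d => // h IH [|[|e]] //=; first by rewrite addn0.
  rewrite negbK !ltnS => lt ev_e; rewrite !addnS ev_level_step2 ?IH //; lia.
elim: d {par} => [|d IH]; first by rewrite addn0.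
by rewrite addnS ev_level_step1 ?IH //; lia.
Qed.

(** The level [(n + size la).*2] is even and large enough for [levelP]; thus in type D the odd
    members come from an even level by setting variables to 0. *)
Definition GXfamily n : {mpoly F[n]} :=
  ev (@mpolyC n F) (mvars n F) (level (n + size la).*2).

Lemma GXfamily_step n :
  ev (@mpolyC n F) (mvars n F) (GXfamily n.+1) = GXfamily n.
Proof.
rewrite [LHS]ev_trunc ?size_mvars //.
by apply: ev_level_stable => [|||_]; rewrite ?size_mvars ?odd_double //; lia.
Qed.

Lemma GXfamily_level n : (size la <= n)%N -> (X = tD -> ~~ odd n) ->
  GXfamily n = level n.
Proof.
move=> sz par; rewrite -[RHS]ev_mvars; apply: ev_level_stable => [|||D] //.
- by rewrite size_mvars.
- by lia.
- by rewrite odd_double (negPf (par D)).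
Qed.

End Levels.

(** * Effect of the reflections on row expansions *)

Section Identities.
Variables (L : fieldType) (bt : L).
Implicit Types (c : nat -> L) (la : seq nat) (xs : seq L).

Lemma oplus_shift (a a' x : L) : 1 + bt * a != 0 ->
  x (+)_bt a' =
    (1 + bt * (a' (-)_bt a)) * (x (+)_bt a) + (a' (-)_bt a).
Proof. by move=> nz; rewrite /oplus /ominus; field. Qed.

Lemma oplus_opp (a : L) : 1 + bt * a != 0 -> a (+)_bt (0 (-)_bt a) = 0.
Proof. by move=> nz; rewrite /oplus /ominus; field. Qed.

Lemma oplus_opp_xratio (x y : L) : 1 + bt * y != 0 -> x != y ->
  (x (+)_bt (0 (-)_bt y)) * xratio bt x y = x (+)_bt y.
Proof.
move=> nz xy; have nxy : x - y != 0 by rewrite subr_eq0.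
by rewrite xratioE /oplus /ominus; field; rewrite nz nxy.
Qed.

(* The last factor of a row of length [l.+1] is [x (+) c (last_idx X l)]. *)
Definition last_idx X (l : nat) : nat := if X is tD then l.+1 else l.

(** Positivity excludes the first factor of a row in types B and C, which is [x] or [x (+) x] and
    contains no parameter. *)
Lemma rowX_succ X c l x : (0 < last_idx X l)%N ->
  rowX X bt c l.+1 x = rowX X bt c l x * (x (+)_bt c (last_idx X l)).
Proof.
case: X => //= l0; rewrite /rowP /rowQ big_nat_recr //= ?mulrA //.
by case: eqP => // -[e]; rewrite e in l0.
Qed.

(** * Exchanging two consecutive parameters *)

Section Swap.
Variables (X : ctype) (c c' : nat -> L) (k : nat).
Local Notation i := (last_idx X k).
Hypothesis i_gt0 : (0 < i)%N.
Hypotheses (ci : c' i = c i.+1) (ciS : c' i.+1 = c i).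
Hypothesis c_other : forall j, (0 < j)%N -> j != i -> j != i.+1 -> c' j = c j.

Let lastS l : last_idx X l.+1 = (last_idx X l).+1.
Proof. by case: X. Qed.

Let last_mono l m : (l < m)%N -> (last_idx X l < last_idx X m)%N.
Proof. by case: X. Qed.

(** Rows of length at most [k] contain neither of the exchanged parameters, the row of length [k.+1]
    contains only the first, and longer rows contain both and are symmetric in them. *)
Lemma rowX_swap_lt l x : (l <= k)%N -> rowX X bt c' l x = rowX X bt c l x.
Proof.
elim: l => [|l IH] lk.
  case: X i_gt0 ci ciS c_other => //= _ _ _ _; rewrite /rowP /rowQ !big_geq //.
have [l0|l0] := posnP (last_idx X l).
  case: X l0 => //= ->; last by rewrite /rowQ !big_geq.
  by rewrite /rowP !big_nat1.
rewrite !rowX_succ // IH ?(ltnW lk) // c_other //.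
  by have := last_mono lk; lia.
by have := last_mono lk; lia.
Qed.

Lemma rowX_swap_eq x : rowX X bt c' k.+1 x = rowX X bt c k x * (x (+)_bt c i.+1).
Proof. by rewrite rowX_succ // rowX_swap_lt // ci. Qed.

Lemma rowX_swap_gt l x : (k.+1 < l)%N -> rowX X bt c' l x = rowX X bt c l x.
Proof.
elim: l => // l IH; rewrite ltnS leq_eqVlt => /orP[/eqP <-|lt].
  rewrite rowX_succ ?lastS // rowX_swap_eq ciS [RHS]rowX_succ ?lastS //.
  by rewrite [in RHS]rowX_succ // mulrAC.
have := last_mono lt; rewrite lastS => li.
by rewrite !rowX_succ ?IH ?c_other //; lia.
Qed.

Lemma rowX_swap l x : l != k.+1 -> rowX X bt c' l x = rowX X bt c l x.
Proof.
move=> ne; have [h|h] := leqP l k; first exact: rowX_swap_lt.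
by apply: rowX_swap_gt; lia.
Qed.

Lemma GXsum_swap_other la xs : k.+1 \notin la ->
  GXsum X bt c' la xs = GXsum X bt c la xs.
Proof.
move=> kla; apply: eq_rowsum_fun => l x lla; apply: rowX_swap.
by apply: contraNneq kla => <-.
Qed.

Lemma GXsum_swap_part la1 la2 xs (e := c i.+1 (-)_bt c i) :
  1 + bt * c i != 0 -> k.+1 \notin la1 -> k.+1 \notin la2 ->
  GXsum X bt c' (la1 ++ k.+1 :: la2) xs =
    (1 + bt * e) * GXsum X bt c (la1 ++ k.+1 :: la2) xs +
    e * GXsum X bt c (la1 ++ k :: la2) xs.
Proof.
move=> nz k1 k2; rewrite /GXsum !rowsum_cat.
rewrite (@eq_rowsum_fun _ _ _ (rowX X bt c)) => [|l x lla]; last first.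
  by apply: rowX_swap; apply: contraNneq k1 => <-.
apply: rowsum_lin => ys; apply: rowsum_head_lin => [x _|zs|zs].
- rewrite rowX_swap_eq rowX_succ // (oplus_shift _ _ nz) -/e; ring.
- by apply: eq_rowsum_fun => l x lla; apply: rowX_swap; apply: contraNneq k2 => <-.
- by apply: eq_rowsum_fun => l x lla; apply: rowX_swap; apply: contraNneq k2 => <-.
Qed.

End Swap.

Lemma rowsum_scale (g : nat -> L -> L) tl tl' (u : L) la xs :
  uniq xs -> (size la <= size xs)%N ->
  (forall ys, uniq ys -> {subset ys <= xs} ->
     (size ys + size la)%N = size xs -> tl ys = u * tl' ys) ->
  rowsum bt g tl la xs = u * rowsum bt g tl' la xs.
Proof.
move=> uxs sz e; rewrite (@eq_rowsum _ _ g g tl (fun ys => u * tl' ys + 0 * 0)) //.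
  rewrite (@rowsum_lin _ _ _ _ tl' (fun=> 0) u 0) //; last first.
  by rewrite mul0r addr0.
by move=> ys uys sub szy; rewrite mul0r addr0; exact: e.
Qed.

Hypothesis nz2 : (2 : L) != 0.

Lemma GXsum_equal_parts X c la1 la2 k xs : uniq xs ->
  (size la1 <= size xs)%N -> (0 < last_idx X k)%N ->
  GXsum X bt c (la1 ++ [:: k, k & la2]) xs =
    - bt * GXsum X bt c (la1 ++ [:: k.+1, k & la2]) xs.
Proof.
move=> uxs sz k0; rewrite /GXsum !rowsum_cat; apply: rowsum_scale => // ys uys _ _.
by apply: rowsum_equal_parts => // x _; exact: rowX_succ.
Qed.

Hypothesis nzbt : bt != 0.

Let rowD0 c x : rowX tD bt c 0 x = 1.
Proof. by rewrite /= /rowP big_geq. Qed.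

Let rowD1 c x : rowX tD bt c 1 x = x (+)_bt c 1%N.
Proof. by rewrite /= /rowP big_nat1. Qed.

Let GXsum_last X c la l xs :
  GXsum X bt c (la ++ [:: l]) xs =
    rowsum bt (rowX X bt c) (last_sum bt (rowX X bt c l)) la xs.
Proof. by rewrite cats1 /GXsum rowsum_rcons. Qed.

(** Shortening a row of length 1 in type D leaves an explicit row of length 0, with factor 1. Its
    sum is 1 when an odd number of points remains. *)
Lemma GXsum_last0_odd c la xs : uniq xs -> all (gpoint bt) xs ->
  (size la <= size xs)%N -> odd (size xs - size la) ->
  GXsum tD bt c (la ++ [:: 0%N]) xs = GXsum tD bt c la xs.
Proof.
move=> uxs gxs sz od; rewrite GXsum_last; apply: eq_rowsum => // ys uys sub szy.
rewrite (@eq_last_sum _ _ _ (fun=> 1)) => [|x _]; last exact: rowD0.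
rewrite last_sum1 //; last by apply/allP => y /sub/(allP gxs).
by rewrite -szy addnK in od; rewrite od.
Qed.

(** With an even number of remaining points the two last-row sums are $1 - \prod X$ and $(\prod X -
    1)/\beta$, so the row of length 0 does not disappear. *)
Lemma GXsum_last0_even c la xs : uniq xs -> all (gpoint bt) xs ->
  (size la <= size xs)%N -> ~~ odd (size xs - size la) ->
  GXsum tD bt c (la ++ [:: 0%N]) xs = - bt * GXsum tD bt c (la ++ [:: 1%N]) xs.
Proof.
move=> uxs gxs sz ev; rewrite !GXsum_last; apply: rowsum_scale => // ys uys sub szy.
rewrite -szy addnK in ev; have gys : all (gpoint bt) ys.
  by apply/allP => y /sub/(allP gxs).
rewrite (@eq_last_sum _ _ _ (fun=> 1)) => [|x _]; last exact: rowD0.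
rewrite (@eq_last_sum _ _ (rowX tD bt c 1) (fun x => x (+)_bt c 1%N)) => [|x _];
  last exact: rowD1.
rewrite last_sum1 // last_sum_oplus // (negPf ev).
by field.
Qed.

(** * The reflections at the nodes 0 and $\hat1$ *)

Section SpecialNodes.
Variables (c : nat -> L).
Hypotheses (gc1 : gpoint bt (c 1%N)) (gc2 : gpoint bt (c 2%N)).

Let nc1 : 1 + bt * c 1%N != 0. Proof. by case/and3P: gc1. Qed.
Let nc2 : 1 + bt * c 2%N != 0. Proof. by case/and3P: gc2. Qed.

Section Node0.
Variables (X : ctype) (c' : nat -> L).
Hypotheses (X_BC : X <> tD) (c1' : c' 1%N = 0 (-)_bt c 1%N).
Hypothesis c_other : forall k, (1 < k)%N -> c' k = c k.

Let rowBC_split d l x : (1 < l)%N ->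
  rowX X bt d l x = rowX X bt d 1 x * (x (+)_bt d 1%N) *
    \prod_(2 <= k < l) (x (+)_bt d k).
Proof.
case: X X_BC => // _ l1 /=; rewrite /rowP /rowQ; last first.
  by rewrite big_ltn // [\prod_(1 <= k < 1) _]big_geq // mulr1 mulrA.
rewrite big_nat1 [LHS]big_ltn 1?ltnW // [X in _ * X = _]big_ltn // mulrA /=.
congr (_ * _).
by rewrite big_add1 /= !big_nat; apply: eq_bigr => -[|k].
Qed.

Let row1 d x : rowX X bt d 1 x = if X is tC then x (+)_bt x else x.
Proof.
case: X X_BC => // _ /=; last by rewrite /rowQ big_geq // mulr1.
by rewrite /rowP big_nat1 /= oplus0.
Qed.

Let rows_other l x :
  \prod_(2 <= k < l) (x (+)_bt c' k) = \prod_(2 <= k < l) (x (+)_bt c k).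
Proof. by rewrite !big_nat; apply: eq_bigr => k /andP[/c_other -> _]. Qed.

Let row_at_c1 l : (1 < l)%N -> rowX X bt c' l (c 1%N) = 0.
Proof. by move=> l1; rewrite rowBC_split // c1' oplus_opp // mulr0 mul0r. Qed.

Let row_xratio l x : (1 < l)%N -> x != c 1%N ->
  rowX X bt c' l x * xratio bt x (c 1%N) = rowX X bt c l x.
Proof.
move=> l1 xc; rewrite (rowBC_split c') // (rowBC_split c) // rows_other c1' !row1.
by rewrite -(oplus_opp_xratio nc1 xc); ring.
Qed.

Lemma GXsum_node0_no1 la xs : c 1%N \notin xs -> uniq xs ->
  (size la <= size xs)%N -> (forall l, l \in la -> (1 < l)%N) ->
  GXsum X bt c' la (c 1%N :: xs) = GXsum X bt c la xs.
Proof.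
move=> cxs uxs sz la1; apply: rowsum_add_point => // [l /la1|l x /la1 l1 xin].
  exact: row_at_c1.
by apply: row_xratio => //; apply: contraNneq cxs => <-.
Qed.

Definition eroot0 : L := if X is tC then c 1%N (+)_bt c 1%N else c 1%N.

(** The new point multiplies $\prod X$ by [1 + bt * c 1]. The sums being $(\prod X - 1)/\beta$ in
    type B and $((\prod X)^2 - 1)/\beta$ in type C, the result is an affine function of the old sum
    with coefficients given by the root. *)
Let last_node0 ys : uniq (c 1%N :: ys) -> all (gpoint bt) ys ->
  last_sum bt (rowX X bt c' 1) (c 1%N :: ys) =
    (1 + bt * eroot0) * last_sum bt (rowX X bt c 1) ys + eroot0.
Proof.
move=> uys gys; have uy : uniq ys by case/andP: uys.
have gcys : all (gpoint bt) (c 1%N :: ys) by rewrite /= gc1.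
have E d zs : last_sum bt (rowX X bt d 1) zs =
    last_sum bt (fun x => if X is tC then x (+)_bt x else x) zs.
  by apply: eq_last_sum => x _; exact: row1.
rewrite !{}E /eroot0; case: X X_BC => // _.
  by rewrite !last_sum_id // big_cons; field.
by rewrite !last_sum_double // big_cons /oplus; field.
Qed.

Lemma GXsum_node0_part1 la xs : c 1%N \notin xs -> uniq xs ->
  all (gpoint bt) xs -> (size la <= size xs)%N ->
  (forall l, l \in la -> (1 < l)%N) ->
  GXsum X bt c' (la ++ [:: 1%N]) (c 1%N :: xs) =
    (1 + bt * eroot0) * GXsum X bt c (la ++ [:: 1%N]) xs +
    eroot0 * GXsum X bt c la xs.
Proof.
move=> cxs uxs gxs sz la1; rewrite !GXsum_last.
rewrite -(@rowsum_lin _ _ _ (fun ys => (1 + bt * eroot0) *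
  last_sum bt (rowX X bt c 1) ys + eroot0 * 1)) //.
apply: rowsum_add_point => // [l /la1|l x /la1 l1 xin|ys uys sub _].
- exact: row_at_c1.
- by apply: row_xratio => //; apply: contraNneq cxs => <-.
rewrite last_node0 ?mulr1 //.
  by rewrite /= uys andbT; apply: contra cxs; exact: sub.
by apply/allP => y /sub/(allP gxs).
Qed.

End Node0.

Section NodeHat1.
Variables (c' : nat -> L).
Hypotheses (c1' : c' 1%N = 0 (-)_bt c 2%N) (c2' : c' 2%N = 0 (-)_bt c 1%N).
Hypothesis c_other : forall k, (2 < k)%N -> c' k = c k.
Hypothesis c12 : c 1%N != c 2%N.

Let rowD_split d l x : (1 < l)%N ->
  rowX tD bt d l x = (x (+)_bt d 1%N) * (x (+)_bt d 2%N) *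
    \prod_(3 <= k < l.+1) (x (+)_bt d k).
Proof. by move=> l1; rewrite /= /rowP big_ltn 1?ltnW // big_ltn // mulrA. Qed.

(** The row factor halfway, once the point [c 2] has been absorbed: one parameter is restored to
    [c 2], the other is still the inverse of [c 1] and makes the row vanish at [c 1]. *)
Let mid l x := (x (+)_bt c 2%N) * (x (+)_bt (0 (-)_bt c 1%N)) *
    \prod_(3 <= k < l.+1) (x (+)_bt c k).

Let rows_other l x :
  \prod_(3 <= k < l.+1) (x (+)_bt c' k) = \prod_(3 <= k < l.+1) (x (+)_bt c k).
Proof. by rewrite !big_nat; apply: eq_bigr => k /andP[/c_other -> _]. Qed.

Let add_two tl tl1 tl2 la xs :
  c 1%N \notin xs -> c 2%N \notin xs -> uniq xs -> (size la <= size xs)%N ->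
  (forall l, l \in la -> (1 < l)%N) ->
  (forall ys, uniq ys -> {subset ys <= c 1%N :: xs} ->
     (size ys + size la)%N = (size xs).+1 -> tl1 (c 2%N :: ys) = tl ys) ->
  (forall ys, uniq ys -> {subset ys <= xs} ->
     (size ys + size la)%N = size xs -> tl (c 1%N :: ys) = tl2 ys) ->
  rowsum bt (rowX tD bt c') tl1 la [:: c 2%N, c 1%N & xs] =
    rowsum bt (rowX tD bt c) tl2 la xs.
Proof.
move=> n1 n2 uxs sz la1 e1 e2; have n21 : c 2%N != c 1%N by rewrite eq_sym.
transitivity (rowsum bt mid tl la (c 1%N :: xs)).
  apply: rowsum_add_point => //.
  - by rewrite inE negb_or n21.
  - by rewrite /= n1.
  - exact: leqW.
  - by move=> l /la1 l1; rewrite rowD_split // c1' oplus_opp // !mul0r.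
  move=> l x /la1 l1 xin; rewrite rowD_split // c1' c2' rows_other /mid.
  have xc : x != c 2%N.
    by apply: contraTneq xin => ->; rewrite inE negb_or n21.
  by rewrite -(oplus_opp_xratio nc2 xc); ring.
apply: rowsum_add_point => // [l _|l x /la1 l1 xin].
  by rewrite /mid oplus_opp // mulr0 mul0r.
rewrite rowD_split // /mid.
have xc : x != c 1%N by apply: contraNneq n1 => <-.
by rewrite -(oplus_opp_xratio nc1 xc); ring.
Qed.

Lemma GXsum_hat1_no1 la xs :
  c 1%N \notin xs -> c 2%N \notin xs -> uniq xs -> (size la <= size xs)%N ->
  (forall l, l \in la -> (1 < l)%N) ->
  GXsum tD bt c' la [:: c 2%N, c 1%N & xs] = GXsum tD bt c la xs.
Proof. by move=> n1 n2 uxs sz la1; apply: (add_two (tl := fun=> 1)). Qed.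

(** Two added points preserve the parity and multiply $\prod X$ by $X_{c_1} X_{c_2}$. In the odd
    case the new first parameter brings the factor $X_{c_2}^{-1}$, leaving the $X_{c_1}$ already
    present in the old sum; in the even case the whole product, equal to $1 + \beta (c_1 \oplus
    c_2)$, remains. *)
Let last_hat1 ys : uniq [:: c 2%N, c 1%N & ys] -> all (gpoint bt) ys ->
  last_sum bt (rowX tD bt c' 1) [:: c 2%N, c 1%N & ys] =
  if odd (size ys) then last_sum bt (rowX tD bt c 1) ys
  else (1 + bt * (c 1%N (+)_bt c 2%N)) * last_sum bt (rowX tD bt c 1) ys +
    (c 1%N (+)_bt c 2%N).
Proof.
move=> uys gys; have uy : uniq ys by case/and3P: uys.
have gcys : all (gpoint bt) [:: c 2%N, c 1%N & ys] by rewrite /= gc1 gc2.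
have E d zs : last_sum bt (rowX tD bt d 1) zs =
    last_sum bt (fun x => x (+)_bt d 1%N) zs.
  by apply: eq_last_sum => x _; exact: rowD1.
rewrite !{}E c1' !last_sum_oplus // !big_cons /= negbK.
case: odd; rewrite /oplus /ominus; field; rewrite ?nzbt ?nc2 //.
Qed.

Lemma GXsum_hat1_odd la xs :
  c 1%N \notin xs -> c 2%N \notin xs -> uniq xs -> all (gpoint bt) xs ->
  (size la <= size xs)%N -> (forall l, l \in la -> (1 < l)%N) ->
  odd (size xs - size la) ->
  GXsum tD bt c' (la ++ [:: 1%N]) [:: c 2%N, c 1%N & xs] =
    GXsum tD bt c (la ++ [:: 1%N]) xs.
Proof.
move=> n1 n2 uxs gxs sz la1 od; rewrite !GXsum_last.
apply: (add_two (tl := fun ys => last_sum bt (rowX tD bt c' 1) (c 2%N :: ys))) => //.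
move=> ys uys sub szy; rewrite last_hat1.
- by rewrite -szy addnK in od; rewrite od.
- rewrite /= uys inE negb_or eq_sym c12 andbT /=.
  by apply/andP; split; [apply: contra n2 | apply: contra n1]; exact: sub.
- by apply/allP => y /sub/(allP gxs).
Qed.

Lemma GXsum_hat1_even la xs :
  c 1%N \notin xs -> c 2%N \notin xs -> uniq xs -> all (gpoint bt) xs ->
  (size la <= size xs)%N -> (forall l, l \in la -> (1 < l)%N) ->
  ~~ odd (size xs - size la) ->
  GXsum tD bt c' (la ++ [:: 1%N]) [:: c 2%N, c 1%N & xs] =
    (1 + bt * (c 1%N (+)_bt c 2%N)) * GXsum tD bt c (la ++ [:: 1%N]) xs +
    (c 1%N (+)_bt c 2%N) * GXsum tD bt c la xs.
Proof.
move=> n1 n2 uxs gxs sz la1 od; rewrite !GXsum_last.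
rewrite -(@rowsum_lin _ _ _ (fun ys => (1 + bt * (c 1%N (+)_bt c 2%N)) *
  last_sum bt (rowX tD bt c 1) ys + (c 1%N (+)_bt c 2%N) * 1)) //.
apply: (add_two (tl := fun ys => last_sum bt (rowX tD bt c' 1) (c 2%N :: ys))) => //.
move=> ys uys sub szy; rewrite last_hat1.
- by rewrite -szy addnK in od; rewrite (negPf od) mulr1.
- rewrite /= uys inE negb_or eq_sym c12 andbT /=.
  by apply/andP; split; [apply: contra n2 | apply: contra n1]; exact: sub.
- by apply/allP => y /sub/(allP gxs).
Qed.

End NodeHat1.

End SpecialNodes.

End Identities.

(** * Families of polynomials *)

Lemma mmap_comp_mpoly n m (R L : comNzRingType) (phi : {rmorphism R -> L})
    (v : 'I_m -> L) (p : {mpoly R[n]}) (lq : n.-tuple {mpoly R[m]}) :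
  mmap phi v (p \mPo lq) = mmap phi (fun i => mmap phi v (tnth lq i)) p.
Proof.
rewrite /comp_mpoly mmap_comp; apply: eq_mmap => // c /=.
exact: mmapC.
Qed.

Lemma mmap_map_mpoly n (R S L : comNzRingType) (f : {rmorphism R -> S})
    (phi : {rmorphism S -> L}) (v : 'I_n -> L) (p : {mpoly R[n]}) :
  mmap phi v (map_mpoly f p) = mmap (phi \o f) v p.
Proof.
rewrite /map_mpoly (mmap_comp (@mpolyC n S \o f)); apply: eq_mmap => [c|i] /=.
  exact: mmapC.
by rewrite mmapX mmap1U.
Qed.

Section Families.
Implicit Types F : xfamily.

Lemma set_last0E n (p : {mpoly coef[n.+1]}) :
  set_last0 p = ev (@mpolyC n coef) (mvars n coef) p.
Proof.
apply: eq_mmap => // i; rewrite tnth_mktuple.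
case: unliftP => [j ->|->]; last by rewrite nth_default // size_mvars.
by rewrite lift_max nth_mvars.
Qed.

Lemma ev_invlim F (L : comNzRingType) (phi : {rmorphism coef -> L}) xs n :
  in_invlim F -> (size xs <= n)%N -> ev phi xs (F n.+1) = ev phi xs (F n).
Proof. by move=> iF sz; rewrite -(iF n) set_last0E ev_trunc. Qed.

Lemma ev_s0 F (L : comNzRingType) (phi : {rmorphism coef -> L}) xs n :
  ev phi xs (s0 F n) = ev (phi \o sigma0) (phi (b 1) :: xs) (F n.+1).
Proof.
rewrite /ev /s0 mmap_comp_mpoly mmap_map_mpoly; apply: eq_mmap => // i.
rewrite tnth_mktuple; case: unliftP => [j ->|->] /=; last by rewrite mmapC.
by rewrite mmapX mmap1U.
Qed.

Lemma ev_s_pos F (L : comNzRingType) (phi : {rmorphism coef -> L}) xs i n :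
  ev phi xs (s_pos i.+1 F n) = ev (phi \o sigmaS i) xs (F n).
Proof. exact: (mmap_map_mpoly (sigmaS i) phi (fun j : 'I_n => nth 0 xs j) (F n)). Qed.

Lemma invlim_ev F :
  (forall n, ev (@mpolyC n coef) (mvars n coef) (F n.+1) =
             ev (@mpolyC n coef) (mvars n coef) (F n)) -> in_invlim F.
Proof. by move=> h n; rewrite set_last0E h ev_mvars. Qed.

Lemma s0_invlim F : in_invlim F -> in_invlim (s0 F).
Proof.
move=> iF; apply: invlim_ev => n.
have sz : (size ((b 1)%:MP :: mvars n coef) <= n.+1)%N by rewrite /= size_mvars.
have e := ev_invlim (@mpolyC n coef \o sigma0) iF sz.
exact: etrans (ev_s0 F _ _ n.+1) (etrans e (esym (ev_s0 F _ _ n))).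
Qed.

Lemma s_pos_invlim F i : in_invlim F -> in_invlim (s_pos i.+1 F).
Proof.
move=> iF; apply: invlim_ev => n.
have sz : (size (mvars n coef) <= n)%N by rewrite size_mvars.
have e := ev_invlim (@mpolyC n coef \o sigmaS i) iF sz.
exact: etrans (ev_s_pos F _ _ i n.+1) (etrans e (esym (ev_s_pos F _ _ i n))).
Qed.

Lemma sop_invlim F i : in_invlim F -> in_invlim (sop i F).
Proof.
case: i => [|[|i]] iF /=.
- exact/s0_invlim/s_pos_invlim/s0_invlim.
- exact: s0_invlim.
- exact: s_pos_invlim.
Qed.

Lemma ddiff_invlim X i F : in_invlim F -> in_invlim (ddiff X i F).
Proof.
move=> iF n; have := sop_invlim i iF n; have := iF n.
rewrite /set_last0 /ddiff => e1 e2.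
by rewrite linearZ /= linearB linearZ /= e1 e2.
Qed.

(** Each level is obtained from any higher one by setting variables to 0, so large even levels
    determine the family. *)
Lemma invlim_eq F H N : in_invlim F -> in_invlim H ->
  (forall n, (N <= n)%N -> ~~ odd n -> F n = H n) -> F = H.
Proof.
move=> iF iH e; apply: functional_extensionality_dep => n.
have down d m : F (d + m)%N = H (d + m)%N -> F m = H m.
  elim: d => // d IH eS; apply: IH; rewrite -(iF (d + m)%N) -(iH (d + m)%N).
  by congr set_last0.
(* The level [(n + N.*2) + n] is even, at least [N], and lies above [n]. *)
apply: (down (n + N.*2)%N); apply: e; rewrite ?oddD ?odd_double; lia.
Qed.

End Families.

Section GXexistence.
Variable n : nat.
Let phi := fconst coef n.

Lemma fvarsE : fvars coef n = [seq xvar i | i <- enum 'I_n].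
Proof. by rewrite /fvars /mvars -map_comp. Qed.

Lemma xvar_inj : injective (@xvar n).
Proof. by move=> i j /tofrac_inj/mpolyX_inj. Qed.

Lemma symmetrizeE g la : (size la <= n)%N ->
  symmetrize g la = rowsum (phi beta) g (fun=> 1) la (fvars coef n).
Proof.
move=> sz; rewrite fvarsE.
have nz : (n - size la)`!%:R != 0 :> {fraction {mpoly coef[n]}}.
  rewrite -(rmorph_nat phi) fmorph_eq0 -(prednK (fact_gt0 _)).
  exact: coef_natr_neq0.
have e := perm_sumE (phi beta) g xvar_inj sz.
by rewrite -[RHS](mulKf nz) -e.
Qed.

Lemma GX_levelE X la : (size la <= n)%N ->
  GX_level X la n = GXsum X (phi beta) (phi \o b) la (fvars coef n).
Proof.
move=> sz; rewrite /GXsum; case: X => /=.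
- rewrite /GP symmetrizeE //; apply: eq_rowsum_fun => l x _.
  have e0 : xconst n 0 = 0 := rmorph0 phi.
  by apply: eq_bigr => k _; case: eqP => // _; rewrite e0.
- exact: symmetrizeE.
- exact: symmetrizeE.
Qed.

End GXexistence.

Lemma is_GX_family X la : strict_partition la ->
  is_GX X la (GXfamily beta b X la).
Proof.
case/andP => _ la0; split=> [|n sz par].
  apply: invlim_ev => n; rewrite ev_mvars.
  exact: GXfamily_step natD_beta_nat_neq0 la0 n.
rewrite (GXfamily_level b natD_beta_nat_neq0 la0 sz par) GX_levelE // tofrac_fvars.
apply: (levelP _ _ natD_beta_nat_neq0 sz); first exact: fvars_uniq.
exact: size_fvars.
Qed.

Lemma GXP X la : strict_partition la -> is_GX X la (GX X la).
Proof.
move=> st; apply: (epsilon_spec _ (is_GX X la)).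
by exists (GXfamily beta b X la); exact: is_GX_family.
Qed.

(** The defining property of [GX] fixes its value at the variables only; this identifies it with
    [level], whose formula holds at all distinct points and for all embeddings. *)
Lemma ev_GX X la n (L : fieldType) (phi : {rmorphism coef -> L}) xs :
  strict_partition la -> (size la <= n)%N -> (X = tD -> ~~ odd n) ->
  uniq xs -> size xs = n ->
  ev phi xs (GX X la n) = GXsum X (phi beta) (phi \o b) la xs.
Proof.
move=> st sz par uxs sxs; have [_ /(_ n sz par) e] := GXP X st.
have {e} -> : GX X la n = level beta b X la n.
  apply: tofrac_inj; rewrite e GX_levelE // tofrac_fvars.
  apply/esym; apply: (levelP _ _ natD_beta_nat_neq0 sz); first exact: fvars_uniq.
  exact: size_fvars.
exact: (levelP _ _ natD_beta_nat_neq0 sz).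
Qed.

(** * The divided difference operators *)

Lemma rmorph_oplus (F L : fieldType) (phi : {rmorphism F -> L}) (bt x y : F) :
  phi (x (+)_bt y) = phi x (+)_(phi bt) phi y.
Proof. by rewrite /oplus !(rmorphD, rmorphM). Qed.

Lemma rmorph_ominus (F L : fieldType) (phi : {rmorphism F -> L}) (bt x y : F) :
  phi (x (-)_bt y) = phi x (-)_(phi bt) phi y.
Proof. by rewrite /ominus rmorphM rmorphB fmorphV rmorphD rmorphM rmorph1. Qed.

Lemma rmorph_opp_eq (F L : fieldType) (phi : {rmorphism F -> L}) (bt x : F)
    (bt' x' : L) :
  phi bt = bt' -> phi x = x' -> phi (0 (-)_bt x) = 0 (-)_bt' x'.
Proof. by move=> <- <-; rewrite rmorph_ominus rmorph0. Qed.

Lemma comp3_eq (A L : nzRingType) (f : {rmorphism A -> L})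
    (g h k : {rmorphism A -> A}) (x y : A) :
  g (h (k x)) = y -> (((f \o g) \o h) \o k) x = f y.
Proof. by move=> <-. Qed.

Lemma uniq_cons2 (T : eqType) (x y : T) s :
  x != y -> x \notin s -> y \notin s -> uniq s -> uniq [:: y, x & s].
Proof. by move=> xy xs ys us; rewrite /= inE negb_or eq_sym xy xs ys. Qed.

Lemma rmorph_gpoint (F L : fieldType) (phi : {rmorphism F -> L}) (bt x : F) :
  gpoint bt x -> gpoint (phi bt) (phi x).
Proof.
rewrite /gpoint -rmorphM -{1}(rmorph1 phi) -(rmorph_nat phi 2) -!rmorphD.
by rewrite !fmorph_eq0.
Qed.

(** Each forbidden equality would make a variable equal to a constant, namely 0, $-1/\beta$ or
    $-2/\beta$. *)
Lemma fvars_gpoint (F : fieldType) n (bt : F) : bt != 0 ->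
  all (gpoint (fconst F n bt)) (fvars F n).
Proof.
move=> nz; apply/allP => x xin.
have nc a : x != fconst F n a.
  by apply: contraTneq xin => ->; exact: fconst_notin_fvars.
have nl a : fconst F n a + fconst F n bt * x != 0.
  apply: contraNneq (nc (- a / bt)) => e.
  have nzb : fconst F n bt != 0 by rewrite fmorph_eq0.
  apply/eqP; rewrite rmorphM fmorphV; apply: (canRL (mulfK nzb)).
  by rewrite rmorphN mulrC; apply/eqP; rewrite -addr_eq0 addrC e.
apply/and3P; split; first by have := nc 0; rewrite rmorph0.
  by have := nl 1; rewrite rmorph1.
by have := nl 2%:R; rewrite rmorph_nat.
Qed.

(** * Action of each simple reflection at the generic point *)

Section Steps.
Variables (L : fieldType) (phi : {rmorphism coef -> L}) (n : nat) (xs : seq L).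
Hypotheses (xs_uniq : uniq xs) (xs_size : size xs = n).
Hypothesis xs_gpoint : all (gpoint (phi beta)) xs.
Hypothesis xs_generic : forall a, phi a \notin xs.

Let bt := phi beta.
Let c : nat -> L := phi \o b.

Let nz2 : (2 : L) != 0.
Proof. by rewrite -(rmorph_nat phi 2) fmorph_eq0; exact: (coef_natr_neq0 1). Qed.

Let nzbt : bt != 0.
Proof. by rewrite fmorph_eq0; exact: beta_neq0. Qed.

Let gc k : gpoint bt (c k).
Proof.
apply: rmorph_gpoint; apply/and3P; split; first exact: b_neq0.
  exact: (natD_beta_b_neq0 0).
exact: (natD_beta_b_neq0 1).
Qed.

Let nc k : 1 + bt * c k != 0.
Proof. by case/and3P: (gc k). Qed.

Let cxs k : c k \notin xs. Proof. exact: xs_generic. Qed.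

Section OneStep.
Variables (X : ctype) (la : seq nat).
Hypotheses (la_strict : strict_partition la) (la_size : (size la <= n)%N).
Hypothesis n_even : X = tD -> ~~ odd n.

Let cpos k : nat -> L := (phi \o sigmaS k) \o b.

Lemma ev_sop_pos k :
  ev phi xs (sop (nd k.+1) (GX X la) n) = GXsum X bt (cpos k) la xs.
Proof.
rewrite /= ev_s_pos ev_GX //=; rewrite -/(cpos k).
by rewrite sigmaS_beta.
Qed.


Let cposE k j : cpos k j.+1 =
  if j == k then c k.+2 else if j == k.+1 then c k.+1 else c j.+1.
Proof. by rewrite /cpos /= sigmaS_b; do 2?case: ifP. Qed.

(* Exchanging [b_(k+1)] and [b_(k+2)] affects the rows of length
   [(below k).+1]. *)
Let below k := if X is tD then k else k.+1.

Let last_below k : last_idx X (below k) = k.+1.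
Proof. by rewrite /below; case: X. Qed.

Let cpos_i k : cpos k (last_idx X (below k)) = c (last_idx X (below k)).+1.
Proof. by rewrite last_below cposE eqxx. Qed.

Let cpos_iS k : cpos k (last_idx X (below k)).+1 = c (last_idx X (below k)).
Proof. by rewrite last_below cposE gtn_eqF // eqxx. Qed.

Let cpos_other k j : (0 < j)%N -> j != last_idx X (below k) ->
  j != (last_idx X (below k)).+1 -> cpos k j = c j.
Proof.
by rewrite last_below; case: j => // j _; rewrite !eqSS cposE => /negPf-> /negPf->.
Qed.

Let below_gt0 k : (0 < last_idx X (below k))%N. Proof. by rewrite last_below. Qed.

Let epos k : phi (eroot X (nd k.+1)) = c k.+2 (-)_bt c k.+1.
Proof. by case: X; rewrite /= rmorph_ominus. Qed.

Let swap_part k la1 la2 :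
  (below k).+1 \notin la1 -> (below k).+1 \notin la2 ->
  GXsum X bt (cpos k) (la1 ++ (below k).+1 :: la2) xs =
    (1 + bt * phi (eroot X (nd k.+1))) *
      GXsum X bt c (la1 ++ (below k).+1 :: la2) xs +
    phi (eroot X (nd k.+1)) * GXsum X bt c (la1 ++ below k :: la2) xs.
Proof.
move=> n1 n2; rewrite epos -(last_below k).
apply: GXsum_swap_part => //; exact: cpos_other.
Qed.

Let split_pos la1 l la2 : la = la1 ++ l :: la2 ->
  [/\ l \notin la1, l \notin la2, (size la1 <= size xs)%N & (0 < l)%N].
Proof.
move=> e; move: la_strict la_size; rewrite e strict_cat.
case/and4P => /allP h1 /allP h2 l0 _; rewrite size_cat /= => sz; split=> //.
- by apply/negP => /h1 /=; rewrite ltnn.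
- by apply/negP => /h2 /=; rewrite ltnn.
- by rewrite xs_size; lia.
Qed.

Lemma step_pos_removal k mu : removal X (nd k.+1) la mu ->
  ev phi xs (sop (nd k.+1) (GX X la) n) =
    (1 + bt * phi (eroot X (nd k.+1))) * GXsum X bt c la xs +
    phi (eroot X (nd k.+1)) * GXsum X bt c mu xs.
Proof.
case/(removal_shape la_strict) => la1 [l [la2 [laE muE iE]]].
have [n1 n2 sz1 l0] := split_pos laE.
have lE : l = (below k).+1.
  have [l1|l1|l1] := ltngtP l 1%N; first by rewrite ltnNge l0 in l1.
    move: iE; rewrite content_gt1 // /below; case: X => -[->] //;
    by rewrite prednK // ltnW.
  by move: iE; rewrite l1 content_1 /below; case: X => //; case: odd => // -[->].
rewrite ev_sop_pos laE lE swap_part -?lE //; congr (_ + _ * _).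
rewrite muE /drop_box; have [l1|nl1] := eqVneq l 1%N; last by rewrite lE.
(* The exchange leaves a row of length 0 where [drop_box] erases it. This occurs only in type D, and
   content 1 means that an odd number of rows lies above, hence that an odd number of points
   remains. *)
have b0 : below k = 0%N by rewrite l1 in lE; case: lE.
have XD : X = tD by move: b0; rewrite /below; case: X.
have la2E : la2 = [::].
  by apply: (@strict_last1 la1); rewrite -l1 -laE.
rewrite b0 la2E XD; apply: GXsum_last0_odd => //.
move: iE; rewrite XD l1 content_1.
have := n_even XD; rewrite -xs_size => ev_n.
by rewrite oddB // (negPf ev_n) /=; case: odd.
Qed.

Lemma step_pos_not_removable k : ~ removable X (nd k.+1) la ->
  ev phi xs (sop (nd k.+1) (GX X la) n) = GXsum X bt c la xs.
Proof.
move=> nrem; rewrite ev_sop_pos.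
have [lla|nla] := boolP ((below k).+1 \in la); last first.
  apply: GXsum_swap_other nla => //; exact: cpos_other.
have [la1 [la2 [laE n1 n2]]] := strict_split la_strict lla.
have [_ _ sz1 _] := split_pos laE.
have st := la_strict; rewrite laE in st.
suff E : GXsum X bt c (la1 ++ below k :: la2) xs = - bt * GXsum X bt c la xs.
  rewrite laE swap_part // E laE; ring.
(* If the affected row has length 1 (type D, node 1), an odd number of remaining points would give
   its box content 1 and make it removable, so that number is even. *)
have [b0|b0] := posnP (below k).
  have XD : X = tD by move: b0; rewrite /below; case: X.
  have la2E : la2 = [::] by apply: (@strict_last1 la1); rewrite -b0.
  rewrite laE b0 la2E XD; apply: GXsum_last0_even => //.
  have := n_even XD; rewrite -xs_size => ev_n; rewrite oddB // (negPf ev_n) /=.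
  apply/negP => od; apply: nrem; rewrite laE b0 la2E.
  have k0 : k = 0%N by move: b0; rewrite /below XD.
  have -> : nd k.+1 = content X ((size la1).+1, size la1 + 1)%N.
    by rewrite XD content_1 od k0.
  rewrite b0 la2E in st; apply: removal_intro => //; rewrite /drop_box eqxx.
  exact: strict_prefix st.
have iE : content X ((size la1).+1, size la1 + (below k).+1)%N = nd k.+1.
  by rewrite content_gt1 // /below; case: X.
rewrite laE -iE in nrem.
have [la3 la2E] := not_removable_next (b0 : (1 < (below k).+1)%N) st nrem.
by rewrite laE la2E /=; apply: GXsum_equal_parts.
Qed.

Let c0 : nat -> L := (phi \o sigma0) \o b.

(** Here [s0] reads the level [n.+1]. In type D that level is odd, so the formula by symmetrization
    is available only for [hat1], which reads the level [n.+2]. *)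
Lemma ev_sop_0 : X <> tD ->
  ev phi xs (sop (nd 0) (GX X la) n) = GXsum X bt c0 la (c 1%N :: xs).
Proof.
move=> nD; rewrite /= ev_s0 ev_GX //= -/c0 ?sigma0_beta //.
- exact: leqW.
- by rewrite xs_uniq (cxs 1).
- by rewrite xs_size.
Qed.

Let c0_1 : c0 1%N = 0 (-)_bt c 1%N.
Proof. by rewrite /c0 /= sigma0_b rmorph_ominus rmorph0. Qed.

Let c0_other k : (1 < k)%N -> c0 k = c k.
Proof. by case: k => [|[|k]] // _; rewrite /c0 /= sigma0_b. Qed.

Let e0 : X <> tD -> phi (eroot X (nd 0)) = eroot0 bt c X.
Proof. by case: X => //= _; rewrite rmorph_oplus. Qed.

Lemma step_0_removal mu : X <> tD -> removal X (nd 0) la mu ->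
  ev phi xs (sop (nd 0) (GX X la) n) =
    (1 + bt * phi (eroot X (nd 0))) * GXsum X bt c la xs +
    phi (eroot X (nd 0)) * GXsum X bt c mu xs.
Proof.
move=> nD /(removal_shape la_strict) [la1 [l [la2 [laE muE iE]]]].
have [_ _ sz1 l0] := split_pos laE.
have l1 : l = 1%N.
  have [l1|l1|//] := ltngtP l 1%N; first by rewrite ltnNge l0 in l1.
  move: iE; rewrite content_gt1 //; case: X nD => // _ [].
    by case: l l1 {laE muE l0} => [|[]].
  by case: l l1 {laE muE l0} => [|[]].
have st := la_strict; rewrite laE l1 in st.
have la2E := strict_last1 st; rewrite muE l1 /drop_box eqxx ev_sop_0 // e0 //.
rewrite laE l1 la2E; apply: GXsum_node0_part1 => //.
by move: st; rewrite strict_cat => /and4P[/allP].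
Qed.

Lemma step_0_not_removable : X <> tD -> ~ removable X (nd 0) la ->
  ev phi xs (sop (nd 0) (GX X la) n) = GXsum X bt c la xs.
Proof.
move=> nD nrem; rewrite ev_sop_0 //.
have [la1|nla1] := boolP (1%N \in la); last first.
  apply: GXsum_node0_no1 => //; first by rewrite xs_size.
  exact: strict_no1.
have [la' [laE _ st']] := strict_part1 la_strict la1; case: nrem.
have -> : nd 0 = content X ((size la').+1, size la' + 1)%N.
  by rewrite content_1; case: X nD.
by rewrite laE; apply: removal_intro; rewrite -?laE // /drop_box eqxx.
Qed.

End OneStep.

Section HatStep.
Variable la : seq nat.
Hypotheses (la_strict : strict_partition la) (la_size : (size la <= n)%N).
Hypothesis n_even : ~~ odd n.

Let chat : nat -> L := (((phi \o sigma0) \o sigmaS 0) \o sigma0) \o b.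

Let c12 : c 1%N != c 2%N.
Proof. by rewrite /c /= (inj_eq (fmorph_inj phi)) b_inj. Qed.

Lemma ev_sop_hat1 :
  ev phi xs (sop hat1 (GX tD la) n) = GXsum tD bt chat la [:: c 2%N, c 1%N & xs].
Proof.
(* The outer [s0] adds the point [c 1]. The inner one adds [b 1] transformed by the two operators
   applied after it, that is, [c 2]. *)
have b2E : phi (sigma0 (sigmaS 0 (b 1))) = c 2%N.
  by rewrite sigmaS_b /= sigma0_b.
pose psi : {rmorphism coef -> L} := ((phi \o sigma0) \o sigmaS 0) \o sigma0.
have hbeta : sigma0 (sigmaS 0 (sigma0 beta)) = beta :=
  etrans (congr1 sigma0 (etrans (congr1 (sigmaS 0) sigma0_beta) (sigmaS_beta 0)))
    sigma0_beta.
have psi_beta : psi beta = bt by exact: comp3_eq hbeta.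
have us := uniq_cons2 c12 (cxs 1) (cxs 2) xs_uniq.
have ss : size [:: c 2%N, c 1%N & xs] = n.+2 by rewrite /= xs_size.
have en : tD = tD -> ~~ odd n.+2 by rewrite /= negbK.
have := ev_GX psi la_strict (leqW (leqW la_size)) en us ss.
rewrite psi_beta => <-; rewrite -b2E.
have e1 := ev_s0 (s_pos 1 (s0 (GX tD la))) phi xs n.
have e2 := ev_s_pos (s0 (GX tD la)) (phi \o sigma0) (c 1%N :: xs) 0 n.+1.
have e3 := ev_s0 (GX tD la) ((phi \o sigma0) \o sigmaS 0) (c 1%N :: xs) n.+1.
exact: etrans e1 (etrans e2 e3).
Qed.

Let chatE k y z u : sigma0 (b k) = y -> sigmaS 0 y = z -> sigma0 z = u ->
  chat k = phi u.
Proof. by move=> e1 e2 e3; apply: comp3_eq; rewrite -e3 -e2 -e1. Qed.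

Let chat_1 : chat 1%N = 0 (-)_bt c 2%N.
Proof.
have h1 := sigma0_b 0; have h2 := rmorph_opp_eq (sigmaS_beta 0) (sigmaS_b 0 0).
have h3 := rmorph_opp_eq sigma0_beta (sigma0_b 1).
exact: etrans (chatE h1 h2 h3) (rmorph_opp_eq (erefl bt) (erefl (c 2%N))).
Qed.

Let chat_2 : chat 2%N = 0 (-)_bt c 1%N.
Proof.
have h := chatE (sigma0_b 1) (sigmaS_b 0 1) (sigma0_b 0).
exact: etrans h (rmorph_opp_eq (erefl bt) (erefl (c 1%N))).
Qed.

Let chat_other k : (2 < k)%N -> chat k = c k.
Proof.
case: k => [|[|[|k]]] // _.
exact: chatE (sigma0_b k.+2) (sigmaS_b 0 k.+2) (sigma0_b k.+2).
Qed.

Let ehat : phi (eroot tD hat1) = c 1%N (+)_bt c 2%N.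
Proof. by rewrite /= rmorph_oplus. Qed.

Let part1_cases la1 : la = la1 ++ [:: 1%N] ->
  [/\ (size la1 <= size xs)%N, forall l, l \in la1 -> (1 < l)%N &
      odd (size xs - size la1) = odd (size la1)].
Proof.
move=> e; have sz : (size la1 <= size xs)%N.
  by rewrite xs_size (leq_trans _ la_size) // e size_cat leq_addr.
split=> //; last by rewrite oddB // xs_size (negPf n_even).
by move: la_strict; rewrite e strict_cat => /and4P[/allP].
Qed.

Lemma step_hat1_removal mu : removal tD hat1 la mu ->
  ev phi xs (sop hat1 (GX tD la) n) =
    (1 + bt * phi (eroot tD hat1)) * GXsum tD bt c la xs +
    phi (eroot tD hat1) * GXsum tD bt c mu xs.
Proof.
case/(removal_shape la_strict) => la1 [l [la2 [laE muE iE]]].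
have st := la_strict; rewrite laE in st.
have l0 : (0 < l)%N by move: st; rewrite strict_cat => /and4P[].
have l1 : l = 1%N.
  have [l1|l1|//] := ltngtP l 1%N; first by rewrite ltnNge l0 in l1.
  by move: iE; rewrite content_gt1.
rewrite l1 in st; have la2E := strict_last1 st.
rewrite l1 la2E in laE; have [sz gt1 par] := part1_cases laE.
rewrite muE l1 /drop_box eqxx ev_sop_hat1 ehat laE.
apply: GXsum_hat1_even => //; rewrite par.
by move: iE; rewrite l1 content_1; case: odd.
Qed.

Lemma step_hat1_not_removable : ~ removable tD hat1 la ->
  ev phi xs (sop hat1 (GX tD la) n) = GXsum tD bt c la xs.
Proof.
move=> nrem; rewrite ev_sop_hat1.
have [la1|nla1] := boolP (1%N \in la); last first.
  apply: GXsum_hat1_no1 => //; first by rewrite xs_size.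
  exact: strict_no1.
have [la' [laE _ st']] := strict_part1 la_strict la1.
have [sz gt1 par] := part1_cases laE.
rewrite laE; apply: GXsum_hat1_odd => //; rewrite par.
apply/negPn/negP => ev'; apply: nrem.
have -> : hat1 = content tD ((size la').+1, size la' + 1)%N.
  by rewrite content_1 (negPf ev').
by rewrite laE; apply: removal_intro; rewrite -?laE // /drop_box eqxx.
Qed.

End HatStep.

End Steps.

Lemma eroot_neq0 X i : simple_index X i -> eroot X i != 0.
Proof.
have pos k : b k.+2 (-)_beta b k.+1 != 0.
  apply: mulf_neq0; first by rewrite subr_eq0 b_inj // gtn_eqF.
  by rewrite invr_eq0; exact: (natD_beta_b_neq0 0).
case: X i => [] [|[|k]] // _;
  [exact: b_neq0|exact: pos|exact: oplus_b_neq0|exact: pos|exact: oplus_b_neq0|].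
exact: pos.
Qed.

Lemma solve_ddiff (F : fieldType) n (bt e : F) (p q r : {mpoly F[n]}) :
  e != 0 ->
  ev (fconst F n) (fvars F n) p =
    (1 + fconst F n bt * fconst F n e) * ev (fconst F n) (fvars F n) q +
    fconst F n e * ev (fconst F n) (fvars F n) r ->
  e^-1 *: (p - (1 + bt * e) *: q) = r.
Proof.
move=> e0; rewrite -!tofrac_fvars => h.
have -> : p = (1 + bt * e) *: q + e *: r.
  apply: tofrac_inj; rewrite h -(rmorphM (fconst F n)) -(rmorph1 (fconst F n)).
  by rewrite -rmorphD /= -!rmorphM -rmorphD !mul_mpolyC.
by rewrite addrAC subrr add0r scalerA mulVf // scale1r.
Qed.

Lemma ddiff_eq X i F H N : simple_index X i -> in_invlim F -> in_invlim H ->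
  (forall n, (N <= n)%N -> ~~ odd n ->
     let phi := fconst coef n in let xs := fvars coef n in
     ev phi xs (sop i F n) =
       (1 + phi beta * phi (eroot X i)) * ev phi xs (F n) +
       phi (eroot X i) * ev phi xs (H n)) ->
  ddiff X i F = H.
Proof.
move=> si iF iH e.
apply: (@invlim_eq _ _ N (ddiff_invlim X i iF) iH) => n nN nev.
exact: solve_ddiff (eroot_neq0 si) (e n nN nev).
Qed.

Lemma removal_size X i la mu : strict_partition la -> removal X i la mu ->
  (size mu <= size la)%N.
Proof.
move=> st /(removal_shape st)[la1 [l [la2 [-> -> _]]]].
by rewrite /drop_box; case: ifP => _; rewrite !size_cat //= leq_addr.
Qed.

Theorem theorem6p4 (X : ctype) (la : seq nat) (i : node)
    (la_strict : strict_partition la) (i_simple : simple_index X i) :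
  (forall mu : seq nat, removal X i la mu -> ddiff X i (GX X la) = GX X mu) /\
  (~ removable X i la ->
     ddiff X i (GX X la) = fun n : nat => - beta *: GX X la n).
Proof.
have [iG _] := GXP X la_strict.
have evG n nu : strict_partition nu -> (size nu <= n)%N -> ~~ odd n ->
    ev (fconst coef n) (fvars coef n) (GX X nu n) =
      GXsum X (fconst coef n beta) (fconst coef n \o b) nu (fvars coef n).
  by move=> st sz nev; apply: ev_GX; rewrite ?fvars_uniq ?size_fvars.
split=> [mu rem|nrem].
  have stm : strict_partition mu by case: rem => a [].
  have [iGm _] := GXP X stm.
  apply: (@ddiff_eq X i _ _ (size la) i_simple iG iGm) => n sz nev phi xs.
  rewrite !evG ?(leq_trans (removal_size la_strict rem)) //.
  have ux := fvars_uniq coef n; have sx := size_fvars coef n.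
  have gx := fvars_gpoint n beta_neq0; have nx := @fconst_notin_fvars coef n.
  case: i i_simple rem => [|[|k]].
  - move=> sh rem; have XD : X = tD by move: sh; clear; case: X.
    by subst X; apply: (step_hat1_removal ux sx gx nx).
  - by move=> s0 rem; apply: (step_0_removal ux sx gx nx) => // XD; rewrite XD in s0.
  - by move=> _ rem; apply: (step_pos_removal ux sx gx).
have iGb : in_invlim (fun n => - beta *: GX X la n).
  by move=> n; rewrite -[in RHS](iG n) /set_last0 linearZ.
apply: (@ddiff_eq X i _ _ (size la) i_simple iG iGb) => n sz nev phi xs.
have -> : ev phi xs (- beta *: GX X la n) = - phi beta * ev phi xs (GX X la n).
  by rewrite /ev mmapZ rmorphN.
(* For the target $-\beta\,GX$ the required value collapses to that of $GX$: what remains is that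
   the reflection fixes $GX$. *)
have -> : forall u v w : {fraction {mpoly coef[n]}},
    (1 + u * v) * w + v * (- u * w) = w by move=> u v w; ring.
rewrite evG //.
have ux := fvars_uniq coef n; have sx := size_fvars coef n.
have gx := fvars_gpoint n beta_neq0; have nx := @fconst_notin_fvars coef n.
case: i i_simple nrem => [|[|k]].
- move=> sh nrem; have XD : X = tD by move: sh; clear; case: X.
  by subst X; apply: (step_hat1_not_removable ux sx gx nx).
- by move=> s0 nrem; apply: (step_0_not_removable ux sx nx) => // XD; rewrite XD in s0.
- by move=> _ nrem; apply: (step_pos_not_removable ux sx gx).
Qed.
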